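(* Let $E$ be a separable real Hilbert space and let $1\leq p<\infty$ be such that $p$ is not an even integer. If $\Phi\colon\mathcal{W}_p(E)\to\mathcal{W}_p(E)$ is an isometry (distance preserving bijection), then there exists an (affine) isometry $\psi\colon E\to E$ such that $\Phi(\mu)=\psi_\#\mu$ for all $\mu\in\mathcal{W}_p(E)$.
   Context: For $1\le p<\infty$, $\mathcal{W}_p(E)$ is the set of Borel probability measures $\mu$ on $E$ with $\int_E\|x\|^p\,d\mu(x)<\infty$, equipped with $d_{\mathcal{W}_p}(\mu,\nu)=\big(\inf_{\pi\in\Pi(\mu,\nu)}\int_{E\times E}\|x-y\|^p\,d\pi(x,y)\big)^{1/p}$, where $\Pi(\mu,\nu)$ is the set of Borel probability measures on $E\times E$ with marginals $\mu$ and $\nu$. For a measurable $g\colon E\to E$, the push-forward is $(g_\#\mu)(A)=\mu(g^{-1}[A])$ for Borel $A$. *)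

(* Defs.v *)
From HB Require Import structures.
From mathcomp Require Import all_boot all_order all_algebra.
From mathcomp Require Import all_classical all_reals all_analysis.
Set Implicit Arguments. Unset Strict Implicit. Unset Printing Implicit Defensive.
Import Order.TTheory GRing.Theory Num.Theory.
Import numFieldNormedType.Exports.
Local Open Scope classical_set_scope.
Local Open Scope ring_scope.

Definition inner_product_inducing_norm (R : realType) (E : normedModType R)
    (ip : E -> E -> R) : Prop :=
  [/\ (forall x y, ip x y = ip y x),
      (forall (a : R) (x y z : E), ip (a *: x + y) z = a * ip x z + ip y z)
    & (forall x, `|x| = Num.sqrt (ip x x))].

Definition hilbert_space (R : realType) (E : completeNormedModType R) : Prop :=
  exists ip : E -> E -> R, inner_product_inducing_norm ip.

Definition separable_space (T : topologicalType) : Prop :=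
  exists D : set T, countable D /\ dense D.

Definition borel (R : realType) (E : normedModType R) :=
  g_sigma_algebraType (@open E).

Section Wasserstein.
Variables (R : realType) (E : normedModType R).
Local Notation BE := (borel E).

Definition normE (x : E) : R := `|x|.
Definition distE (x y : E) : R := `|x - y|.

Definition Wp (p : R) : set (probability BE R) :=
  [set mu | (\int[mu]_(x in [set: BE]) ((normE x) `^ p)%:E < +oo)%E].

Definition coupling (mu nu : probability BE R)
    (pi : probability (BE * BE)%type R) : Prop :=
  forall A : set BE, measurable A ->
    pi (A `*` setT) = mu A /\ pi (setT `*` A) = nu A.

Definition transport_cost (p : R) (pi : probability (BE * BE)%type R) : \bar R :=
  (\int[pi]_(z in [set: (BE * BE)%type]) ((distE z.1 z.2) `^ p)%:E)%E.

(* The p-Wasserstein distance (for mu, nu in W_p(E) the infimum is finite). *)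
Definition wasserstein (p : R) (mu nu : probability BE R) : R :=
  (fine (ereal_inf [set transport_cost p pi |
     pi in [set pi | coupling mu nu pi]])) `^ p^-1.

End Wasserstein.

(* Main.v *)
(** A Dirac mass is characterised metrically: from [delta_x] every [nu] can be
    overshot, i.e. some [eta] (the dilation of [nu] by 2 about [x]) satisfies
    [W(eta,delta_x) >= 2 W(nu,delta_x)] and [W(eta,nu) <= W(nu,delta_x)].
    Conversely, if [mu] has two support points [a <> b] and [nu] is the Dirac
    mass at their midpoint [y], then the product coupling shows that such an
    [eta] forces [|z - x| = |z - y| + |y - x|] for almost all [(z,x)]; a single
    [z <> y] then puts [a] and [b] on the same ray from [y], which is absurd.
    So [Phi] permutes the Dirac masses through an isometry [psi] of [E], which
    is affine because [E] is a Hilbert space.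

    Distances to Dirac masses show that [Phi mu] and [psi # mu] have the same
    potential [x |-> int |x - y|^p].  For [p] not an even integer the potential
    determines the atoms: a finite difference along a line through [x] that
    kills polynomials of degree well above [p] but not [|s|^p], divided by [t^p], is
    bounded and tends to a nonzero multiple of the indicator of [y = x].  Hence
    [Phi mu = psi # mu] for purely atomic [mu]; these are dense, and Markov's
    inequality on closed sets passes the identity to the limit. *)

Require Import Defs.
From HB Require Import structures.
From mathcomp Require Import all_boot all_order all_algebra.
From mathcomp Require Import all_classical all_reals all_analysis.
From mathcomp Require Import measurable_realfun ring lra.
Import Order.TTheory GRing.Theory Num.Theory.
Import numFieldNormedType.Exports.
Local Open Scope classical_set_scope.
Local Open Scope ring_scope.

Set Implicit Arguments. Unset Strict Implicit. Unset Printing Implicit Defensive.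

(** * Dilation differences of real functions *)

Section DilationDifference.
Variable R : realType.
Implicit Types (g h : R -> R) (s t a c : R) (k n : nat).

(* The factor [g (2 t) - 4^j g t] kills even monomials [t^(2j)] and multiplies
   [|t|^p] by [2^p - 4^j], which is nonzero unless [p = 2j]. *)
Fixpoint dildiff k g t : R :=
  if k is k'.+1 then dildiff k' g (2 * t) - 4 ^+ k' * dildiff k' g t
  else g t + g (- t).

Lemma eq_dildiff k g h t : g =1 h -> dildiff k g t = dildiff k h t.
Proof. by move=> gh; elim: k t => [|k IH] t /=; rewrite ?gh ?IH. Qed.

Lemma dildiffD k g h t :
  dildiff k (fun s => g s + h s) t = dildiff k g t + dildiff k h t.
Proof. by elim: k t => [|k IH] t /=; rewrite ?IH; ring. Qed.

Lemma dildiffZ k a g t : dildiff k (fun s => a * g s) t = a * dildiff k g t.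
Proof. by elim: k t => [|k IH] t /=; rewrite ?IH; ring. Qed.

Lemma dildiff_scale k a g t :
  dildiff k (fun s => g (a * s)) t = dildiff k g (a * t).
Proof.
elim: k t => [|k IH] t /=; first by rewrite mulrN.
by rewrite !IH mulrCA.
Qed.

(** Each dilation step multiplies such an eigenfunction by [a - 4 ^+ j]. It is applied to monomials,
    with [a = 2 ^+ n], and to [|s| ^ p], with [a = 2 ^ p]. *)
Lemma dildiff_eigen k a g t : (forall s, g (2 * s) = a * g s) ->
  dildiff k g t = \prod_(j < k) (a - 4 ^+ j) * (g t + g (- t)).
Proof.
move=> ga; elim: k t => [|k IH] t /=; first by rewrite big_ord0 mul1r.
by rewrite !IH big_ord_recr /= -mulrN !ga; ring.
Qed.

(** Odd powers vanish under the symmetrization [g t + g (- t)]; for [n = 2j] the factor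
    [2 ^+ n - 4 ^+ j] of the eigenvalue product is zero. *)
Lemma dildiff_exp k n t : (n < k.*2)%N -> dildiff k (fun s => s ^+ n) t = 0.
Proof.
move=> nk; rewrite (@dildiff_eigen _ (2 ^+ n)); last by move=> s; rewrite exprMn.
have [on|en] := boolP (odd n).
  by rewrite exprNn -signr_odd on expr1 mulN1r subrr mulr0.
have nE : n = (n./2).*2 by rewrite -[LHS]odd_double_half (negbTE en).
have hk : (n./2 < k)%N by rewrite -ltn_double -nE.
rewrite (bigD1 (Ordinal hk)) //= [in X in X - _]nE -mul2n exprM -natrX.
by rewrite subrr !mul0r.
Qed.

Lemma dildiff_poly k (p : {poly R}) t :
  (size p <= k.*2)%N -> dildiff k (horner p) t = 0.
Proof.
move=> sp; rewrite (eq_dildiff _ _ (fun s => horner_coef_wide s sp)).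
have : forall m, (m <= k.*2)%N ->
    dildiff k (fun s => \sum_(i < m) p`_i * s ^+ i) t = 0.
  elim=> [_|m IH mk].
    (* The empty sum is written as a multiple of the identity so that linearity applies. *)
    rewrite (@eq_dildiff _ _ (fun s => 0 * s)).
      by rewrite (@dildiffZ _ 0 id) mul0r.
    by move=> s; rewrite big_ord0 mul0r.
  rewrite (eq_dildiff _ _ (fun s => big_ord_recr _ _)) /=.
  by rewrite dildiffD IH 1?ltnW// dildiffZ dildiff_exp// mulr0 addr0.
exact.
Qed.

(** Only values of [g] at points of size at most [2 ^+ k * |t|] enter, with coefficients depending
    on [k] alone; hence [C] is uniform in [g] and [t]. *)
Lemma dildiff_bound k : exists2 C : R, 0 <= C & forall g t M,
  (forall s, `|s| <= 2 ^+ k * `|t| -> `|g s| <= M) -> `|dildiff k g t| <= C * M.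
Proof.
elim: k => [|k [C C0 IH]].
  exists 2 => // g t M gM /=; rewrite (le_trans (ler_normD _ _))//.
  have := gM t; have := gM (- t); rewrite normrN mul1r lexx => /(_ isT) ? /(_ isT) ?.
  lra.
exists ((1 + 4 ^+ k) * C); first by rewrite mulr_ge0// addr_ge0// exprn_ge0.
move=> g t M gM /=; rewrite (le_trans (ler_normB _ _))//.
have -> : (1 + 4 ^+ k) * C * M = C * M + 4 ^+ k * (C * M) by ring.
rewrite lerD//.
  apply: IH => s hs; apply: gM; rewrite exprS; move: hs.
  by rewrite normrM ger0_norm// mulrCA mulrA.
rewrite normrM ger0_norm ?exprn_ge0// ler_wpM2l ?exprn_ge0//.
apply: IH => s hs; apply: gM; rewrite (le_trans hs)// ler_wpM2r// exprS.
by rewrite ler_peMl ?exprn_ge0// ler1n.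
Qed.

End DilationDifference.

(** * Taylor expansion of real powers at 1 *)

Section Taylor.
Variable R : realType.
Implicit Types (u a : R).

Lemma poly_antiderivative (p : {poly R}) :
  exists q : {poly R}, [/\ q^`() = p, q.[0] = 0 & (size q <= (size p).+1)%N].
Proof.
exists (\poly_(i < (size p).+1) (if i is j.+1 then p`_j / j.+1%:R else 0)); split.
- apply/polyP => i; rewrite coef_deriv coef_poly ltnS.
  case: ltnP => hi; last by rewrite mul0rn nth_default.
  by rewrite -[LHS]mulr_natr divfK// pnatr_eq0.
- by rewrite horner_coef0 coef_poly.
- exact: size_poly.
Qed.

(** Here [1 + u] lies between 1/2 and 3/2, so [|ln (1 + u)| <= ln 2]. *)
Lemma powR_half_bound a : exists2 C : R, 0 <= C &
  forall u, `|u| <= 2^-1 -> `|(1 + u) `^ a| <= C.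
Proof.
exists (2 `^ `|a|) => [|u hu]; first exact: powR_ge0.
rewrite ger0_norm ?powR_ge0//.
have u0 : 0 < 1 + u by move: hu; rewrite ler_norml => /andP[]; lra.
rewrite /powR (gt_eqF u0) (_ : 2 == 0 = false) ?gt_eqF// ler_expR.
apply: le_trans (ler_norm _) _; rewrite normrM ler_wpM2l//.
move: hu; rewrite !ler_norml => /andP[h1 h2].
rewrite lerNl -lnV ?posrE// !ler_ln ?posrE ?invr_gt0//.
rewrite (_ : _ <= 2) /=; first by lra.
by rewrite -[leRHS]invrK lef_pV2 ?posrE ?invr_gt0//; lra.
Qed.

(** Induction on [N] for all exponents at once: if [P] approximates the power [a - 1] to order [N],
    then [1 + a *: Q] with [Q' = P] and [Q(0) = 0] approximates the power [a], and the mean value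
    theorem gains one factor [|u|]. *)
Lemma powR1D_taylor (N : nat) a : exists (P : {poly R}) (C : R),
  [/\ (size P <= N)%N, 0 <= C &
      forall u, `|u| <= 2^-1 -> `|(1 + u) `^ a - P.[u]| <= C * `|u| ^+ N].
Proof.
elim: N a => [|N IH] a.
  have [C C0 hC] := powR_half_bound a.
  by exists 0, C; split; rewrite ?size_poly0// => u hu; rewrite horner0 subr0 mulr1 hC.
have [P [C [sP C0 hP]]] := IH (a - 1).
have [Q [dQ Q0 sQ]] := poly_antiderivative P.
exists (1 + a *: Q), (`|a| * C); split.
- rewrite (leq_trans (size_polyD _ _))// geq_max size_poly1 /=.
  by rewrite (leq_trans (size_scale_leq _ _))// (leq_trans sQ).
- by rewrite mulr_ge0.
move=> u hu.
pose f (v : R) := (1 + v) `^ a - (1 + a *: Q).[v].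
pose df (v : R) := a * ((1 + v) `^ (a - 1) - P.[v]).
have f0 : f 0 = 0 by rewrite /f addr0 powR1 !hornerE Q0 mulr0 addr0 subrr.
have dfP (v : R) : `|v| <= 2^-1 -> is_derive v (1 : R) f (df v).
  move=> hv; have v0 : 0 < 1 + v by move: hv; rewrite ler_norml => /andP[]; lra.
  have d1 : is_derive v 1 (fun w : R => 1 + w) (0 + 1) by exact: is_deriveD.
  have d2 := is_derive1_powR a v0.
  have d3 := @is_derive1_comp _ (@powR R ^~ a) (fun w : R => 1 + w) v _ _ d2 d1.
  have d4 := is_deriveB d3 (is_derive_poly (1 + a *: Q) v).
  apply: is_derive_eq d4 _.
  rewrite add0r mulr1 derivD derivZ dQ -(polyC1 R) derivC add0r hornerZ /df.
  by rewrite mulrBr.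
have dfb (v : R) : `|v| <= `|u| -> `|df v| <= `|a| * C * `|u| ^+ N.
  move=> vu; rewrite /df normrM -mulrA ler_wpM2l//.
  rewrite (le_trans (hP _ (le_trans vu hu)))// ler_wpM2l//.
  by rewrite lerXn2r// nnegrE.
have fc (x y : R) : (forall v, v \in `[x, y] -> `|v| <= `|u|) ->
    {within `[x, y], continuous f}.
  move=> h; apply: derivable_within_continuous => v /h vu.
  by have [] := dfP v (le_trans vu hu).
rewrite -/(f u); have [u0|u0] := leP 0 u.
  have hv (v : R) : v \in `[0, u] -> `|v| <= `|u|.
    by rewrite in_itv/= => /andP[v0 vu]; rewrite !ger0_norm.
  have hv' (v : R) : v \in `]0, u[ -> is_derive v (1 : R) f (df v).
    by move=> /subset_itv_oo_cc /hv vu; apply: dfP; exact: le_trans hu.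
  have [c /hv cu] := MVT_segment u0 hv' (fc _ _ hv).
  by rewrite f0 !subr0 => ->; rewrite normrM exprSr mulrA ler_wpM2r// dfb.
have hv (v : R) : v \in `[u, 0] -> `|v| <= `|u|.
  by rewrite in_itv/= => /andP[v0 vu]; rewrite !ler0_norm ?lerN2// ltW.
have hv' (v : R) : v \in `]u, 0[ -> is_derive v (1 : R) f (df v).
  by move=> /subset_itv_oo_cc /hv vu; apply: dfP; exact: le_trans hu.
have [c /hv cu] := MVT_segment (ltW u0) hv' (fc _ _ hv).
rewrite f0 sub0r => /eqP; rewrite eqr_oppLR => /eqP ->.
by rewrite normrN normrM exprSr mulrA sub0r normrN ler_wpM2r// dfb.
Qed.

End Taylor.

(** * Inner product geometry *)

Section Hilbert.
Variables (R : realType) (E : normedModType R) (ip : E -> E -> R).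
Hypothesis ipN : inner_product_inducing_norm ip.
Implicit Types x y z e : E.

Let ipC x y : ip x y = ip y x. Proof. by have [] := ipN. Qed.
Let ipL a x y z : ip (a *: x + y) z = a * ip x z + ip y z.
Proof. by have [] := ipN. Qed.
Let norm_ip x : `|x| = Num.sqrt (ip x x). Proof. by have [] := ipN. Qed.

Lemma ip0 z : ip 0 z = 0.
Proof. by have := ipL 1 0 0 z; rewrite scale1r addr0; lra. Qed.

Lemma ipD x y z : ip (x + y) z = ip x z + ip y z.
Proof. by rewrite -[x in LHS]scale1r ipL mul1r. Qed.

Lemma ipZ a x z : ip (a *: x) z = a * ip x z.
Proof. by rewrite -[a *: x]addr0 ipL ip0 addr0. Qed.

(** Positivity comes from the norm formula: a negative [ip x x] would have [Num.sqrt] equal to 0,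
    forcing [x = 0] and hence [ip x x = 0]. *)
Lemma ip_norm x : ip x x = `|x| ^+ 2.
Proof.
rewrite norm_ip; have [h|h] := leP 0 (ip x x); first by rewrite sqr_sqrtr.
have : `|x| == 0 by rewrite norm_ip ltr0_sqrtr.
by rewrite normr_eq0 => /eqP x0; move: h; rewrite x0 ip0 ltxx.
Qed.

Lemma norm_sqrD x y : `|x + y| ^+ 2 = `|x| ^+ 2 + 2 * ip x y + `|y| ^+ 2.
Proof. by rewrite -!ip_norm ipD ![ip _ (x + y)]ipC !ipD (ipC y x); ring. Qed.

(** Cauchy-Schwarz is read off from the square of the triangle inequality, which the norm already
    satisfies; the lower bound follows by changing the sign of [x]. *)
Lemma ip_le x y : `|ip x y| <= `|x| * `|y|.
Proof.
have le z : ip z y <= `|z| * `|y|.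
  have := ler_normD z y; rewrite -ler_sqr ?nnegrE ?addr_ge0//.
  by rewrite norm_sqrD sqrrD; lra.
rewrite ler_norml le andbT lerNl -[- ip x y]mulN1r -ipZ.
by rewrite (le_trans (le _))// normrZ normrN1 mul1r.
Qed.

Lemma parallelogram x y :
  `|x + y| ^+ 2 + `|x - y| ^+ 2 = 2 * `|x| ^+ 2 + 2 * `|y| ^+ 2.
Proof.
rewrite !norm_sqrD normrN (ipC x (- y)) -(scaleN1r y) ipZ (ipC y x); ring.
Qed.

(** Stewart's identity. The right side involves only distances among [x], [y] and [c], which is what
    makes isometries affine. *)
Lemma norm_sqr_convex t x y c :
  `|t *: x + (1 - t) *: y - c| ^+ 2 =
  t * `|x - c| ^+ 2 + (1 - t) * `|y - c| ^+ 2 - t * (1 - t) * `|x - y| ^+ 2.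
Proof.
have -> : t *: x + (1 - t) *: y - c = t *: (x - c) + (1 - t) *: (y - c).
  by rewrite !scalerBr addrACA -opprD -scalerDl [t + _]addrC subrK scale1r.
have -> : x - y = (x - c) - (y - c) by rewrite opprB addrA subrK.
move: (x - c) (y - c) => {}x {}y.
rewrite !norm_sqrD !normrZ normrN ipZ (ipC x (_ *: y)) ipZ (ipC x (- y)).
by rewrite -(scaleN1r y) ipZ (ipC y x) !exprMn !real_normK ?num_real//; ring.
Qed.

(** * Dilation differences of the kernel [|z + s *: e| ^ p] *)

Variables (p : R) (N : nat).
Hypotheses (p1 : 1 <= p) (pN : p + 1 <= N%:R).

Let p0 : 0 <= p. Proof. exact: le_trans p1. Qed.

(** This is where [N >= p + 1] enters: a Taylor remainder of order [N] beats [r ^ p] by a full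
    factor [r]. *)
Lemma expr_le_powR (r : R) : 0 <= r -> r <= 1 -> r ^+ N <= r `^ p * r.
Proof.
rewrite le_eqVlt => /predU1P[<-|r0 r1].
  rewrite mulr0 expr0n; case: N pN => //= h.
  by move: h; rewrite leNgt => /negP[]; rewrite ltr_wpDl// (le_lt_trans p0)// ltrDl.
rewrite -powR_mulrn ?(ltW r0)// -[X in _ * X](powRr1 (ltW r0)).
rewrite -powRD ?(gt_eqF r0) ?implybT//.
by apply: ger_powR => //; rewrite r0.
Qed.

(** When [K * t <= |z|] and [|s| <= 2 ^+ N * t], the ratio [q = s / |z|] satisfies [6 * |q| <= 1];
    then [|2 c q + q^2| <= 3 |q| <= 1/2] for [|c| <= 1], the range of the Taylor estimate. *)
Let K : R := 6 * 2 ^+ N.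

(* [|z + s e|^p = |z|^p (1 + u)^(p/2)] with [u] quadratic in [s / |z|]: the
   Taylor polynomial in [u] has degree below [2N] in [s] and is killed. *)
Lemma dildiff_kernel_far : exists2 C : R, 0 <= C & forall e z t,
  `|e| = 1 -> 0 < t -> K * t <= `|z| ->
  `|dildiff N (fun s => `|z + s *: e| `^ p) t| <= C * t `^ p * (t / `|z|).
Proof.
have [P [C [sP C0 hP]]] := powR1D_taylor N (p / 2).
have [D D0 hD] := dildiff_bound R N.
exists (D * (C * (3 * 2 ^+ N) ^+ N)).
  by rewrite !mulr_ge0// exprn_ge0// mulr_ge0// exprn_ge0.
move=> e z t e1 t0 tz.
have K1 : 1 <= K.
  by rewrite /K; have := exprn_ege1 N (ler1n R 2); lra.
have z0 : 0 < `|z| by rewrite (lt_le_trans _ tz)// mulr_gt0// (lt_le_trans _ K1).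
(* The cosine of the angle between [z] and the unit vector [e]; thus
   [|z + s *: e|^2 = |z|^2 (1 + u (s / |z|))]. *)
pose c := ip z e / `|z|.
have c1 : `|c| <= 1.
  rewrite /c normrM normfV normr_id ler_pdivrMr// mul1r.
  by have := ip_le z e; rewrite e1 mulr1.
pose u q : R := 2 * c * q + q ^+ 2.
have gE s : `|z + s *: e| `^ p = `|z| `^ p * (1 + u (`|z|^-1 * s)) `^ (p / 2).
  have -> : `|z| `^ p = (`|z| ^+ 2) `^ (p / 2).
    by rewrite -powR_mulrn// -powRrM mulrCA divff// mulr1.
  have -> : `|z + s *: e| `^ p = (`|z + s *: e| ^+ 2) `^ (p / 2).
    by rewrite -powR_mulrn// -powRrM mulrCA divff// mulr1.
  have -> : `|z + s *: e| ^+ 2 = `|z| ^+ 2 * (1 + u (`|z|^-1 * s)).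
    rewrite norm_sqrD normrZ e1 mulr1 (ipC z) ipZ (ipC e) real_normK ?num_real//.
    by rewrite /u /c; field; rewrite gt_eqF.
  rewrite powRM ?sqr_ge0//.
  have : 0 <= `|z| ^+ 2 * (1 + u (`|z|^-1 * s)).
    rewrite [X in 0 <= X](_ : _ = `|z + s *: e| ^+ 2) ?sqr_ge0//.
    rewrite norm_sqrD normrZ e1 mulr1 (ipC z) ipZ (ipC e) real_normK ?num_real//.
    by rewrite /u /c; field; rewrite gt_eqF.
  by rewrite pmulr_rge0// exprn_gt0.
rewrite (eq_dildiff _ _ gE) dildiffZ.
rewrite (@dildiff_scale _ N _ (fun q => (1 + u q) `^ (p / 2)) t).
pose q2 : {poly R} := (2 * c) *: 'X + 'X^2.
pose Q : {poly R} := P \Po q2.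
have QE q : Q.[q] = P.[u q].
  by rewrite /Q horner_comp /u hornerD hornerZ hornerX hornerXn.
have N0 : (0 < N)%N.
  by rewrite -(ltr_nat R) (lt_le_trans _ pN)// ltr_wpDl.
(* [P] has degree at most [N - 1] and [q2] degree at most 2. *)
have sQ : (size Q <= N.*2)%N.
  rewrite (leq_trans (size_comp_poly_leq _ _))//.
  have : (size q2 <= 3)%N.
    rewrite (leq_trans (size_polyD _ _))// geq_max size_polyXn leqnn andbT.
    by rewrite (leq_trans (size_scale_leq _ _))// size_polyX.
  move=> s3; have a : ((size P).-1 <= N.-1)%N by rewrite -!subn1 leq_sub2r.
  have b : ((size q2).-1 <= 2)%N by rewrite -ltnS; case: (size _) s3.
  by have := leq_mul a b; rewrite muln2 -(prednK N0) doubleS /= => h; rewrite leqW.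
(* The polynomial [Q] is annihilated, so subtracting it is free and only the Taylor remainder has to
   be bounded. *)
have -> : dildiff N (fun q => (1 + u q) `^ (p / 2)) (`|z|^-1 * t) =
    dildiff N (fun q => (1 + u q) `^ (p / 2) - P.[u q]) (`|z|^-1 * t).
  rewrite [RHS](_ : _ = dildiff N
      (fun q => (1 + u q) `^ (p / 2) + (-1) * Q.[q]) (`|z|^-1 * t)).
    by rewrite dildiffD dildiffZ dildiff_poly// mulr0 addr0.
  by apply: eq_dildiff => q; rewrite QE mulN1r.
rewrite [_ * t]mulrC; set r := t / `|z|.
have r0 : 0 <= r by rewrite divr_ge0// ltW.
have rK : K * r <= 1 by rewrite /r mulrA ler_pdivrMr// mul1r.
have r1 : r <= 1 by rewrite (le_trans _ rK)// ler_peMl.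
have bnd : `|dildiff N (fun q => (1 + u q) `^ (p / 2) - P.[u q]) r| <=
    D * (C * (3 * 2 ^+ N * r) ^+ N).
  apply: hD => q; rewrite (ger0_norm r0) => hq.
  have q6 : 6 * `|q| <= 1 by rewrite (le_trans _ rK)// /K -mulrA ler_wpM2l.
  have uq : `|u q| <= 3 * `|q|.
    rewrite /u (le_trans (ler_normD _ _))// !normrM ger0_norm//.
    have : `|c| * `|q| <= `|q| by rewrite ler_piMl.
    have : `|q| * `|q| <= `|q| by rewrite ler_piMl//; have := normr_ge0 q; lra.
    by rewrite -normrM -/c; lra.
  have u2 : `|u q| <= 2^-1 by rewrite (le_trans uq)//; lra.
  rewrite (le_trans (hP _ u2))// ler_wpM2l// lerXn2r ?nnegrE//.
    by rewrite mulr_ge0// mulr_ge0// exprn_ge0.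
  by rewrite (le_trans uq)// -mulrA ler_wpM2l.
rewrite normrM ger0_norm ?powR_ge0//.
have tE : t `^ p = `|z| `^ p * r `^ p.
  by rewrite -powRM// /r mulrCA divff ?gt_eqF// mulr1.
apply: le_trans (ler_wpM2l (powR_ge0 _ _) bnd) _.
rewrite tE exprMn.
set X := (3 * 2 ^+ N) ^+ N.
have DX : 0 <= D * (C * X).
  by rewrite !mulr_ge0// /X exprn_ge0// mulr_ge0// exprn_ge0.
have := ler_wpM2l (powR_ge0 `|z| p) (ler_wpM2l DX (expr_le_powR r0 r1)).
move: X (r ^+ N) (r `^ p) (`|z| `^ p) {DX} => X rN rp zp.
have -> : zp * (D * (C * X) * rN) = zp * (D * (C * (X * rN))) by ring.
by have -> : zp * (D * (C * X) * (rp * r)) = D * (C * X) * (zp * rp) * r by ring.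
Qed.

(** Uniformity in [z] and [t] provides the constant for dominated convergence. The far estimate
    covers [K * t <= |z|]; otherwise every value that enters is at most [((K + 2 ^+ N) * t) ^ p]. *)
Lemma dildiff_kernel_bounded : exists2 C : R, 0 <= C & forall e z t,
  `|e| = 1 -> 0 < t ->
  `|t `^ (- p) * dildiff N (fun s => `|z + s *: e| `^ p) t| <= C.
Proof.
have [C C0 far] := dildiff_kernel_far.
have [D D0 hD] := dildiff_bound R N.
exists (C + D * (K + 2 ^+ N) `^ p); first by rewrite addr_ge0// mulr_ge0// powR_ge0.
move=> e z t e1 t0.
have tp : 0 < t `^ p by rewrite powR_gt0.
rewrite powRN normrM ger0_norm ?invr_ge0 ?powR_ge0// ler_pdivrMl// mulrC.
have K1 : 1 <= K.
  by rewrite /K; have := exprn_ege1 N (ler1n R 2); lra.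
have [h|h] := leP (K * t) `|z|.
  rewrite (le_trans (far _ _ _ e1 t0 h))//.
  have z0 : 0 < `|z| by rewrite (lt_le_trans _ h)// mulr_gt0// (lt_le_trans _ K1).
  rewrite mulrDl (le_trans (y := C * t `^ p))//.
    rewrite ler_piMr ?mulr_ge0 ?(ltW tp)// ler_pdivrMr// mul1r.
    by rewrite (le_trans _ h)// ler_peMl// ltW.
  by rewrite lerDl !mulr_ge0// powR_ge0.
rewrite mulrDl (le_trans (y := D * (K + 2 ^+ N) `^ p * t `^ p))//; last first.
  by rewrite lerDr !mulr_ge0// powR_ge0.
have KN : 0 <= K + 2 ^+ N by rewrite addr_ge0 ?exprn_ge0// (le_trans _ K1).
rewrite -mulrA -powRM ?(ltW t0)//; apply: hD => s hs.
rewrite ger0_norm ?powR_ge0// ge0_ler_powR// ?nnegrE//.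
  by rewrite mulr_ge0// ltW.
rewrite (le_trans (ler_normD _ _))// mulrDl lerD ?(ltW h)//.
by rewrite normrZ e1 mulr1 -(ger0_norm (ltW t0)).
Qed.

(** For fixed [z] the far regime holds once [t] is small, and its bound, divided by [t ^ p], is a
    multiple of [t / |z|]. *)
Lemma dildiff_kernel_cvg e z : `|e| = 1 -> z != 0 ->
  (fun n : nat => n.+1%:R^-1 `^ (- p) *
    dildiff N (fun s => `|z + s *: e| `^ p) (n.+1%:R^-1 : R)) @ \oo --> (0 : R).
Proof.
move=> e1 z0.
have [C C0 far] := dildiff_kernel_far.
have nz : 0 < `|z| by rewrite normr_gt0.
have hcvg : (fun n : nat => (C / `|z|) * n.+1%:R^-1 : R) @ \oo --> (0 : R).
  rewrite -(mulr0 (C / `|z|)); apply: cvgM; first exact: cvg_cst.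
  exact: cvg_harmonic.
have small : \forall n \near \oo, K * n.+1%:R^-1 <= `|z|.
  have : (fun n : nat => K * n.+1%:R^-1 : R) @ \oo --> (0 : R).
    rewrite -(mulr0 K); apply: cvgM; first exact: cvg_cst.
    exact: cvg_harmonic.
  by move=> h; near=> n; apply: ltW; near: n; apply: (cvgr_lt 0 h).
apply/cvgr0Pnorm_le => eps eps0.
near=> n.
have t0 : 0 < n.+1%:R^-1 :> R by rewrite invr_gt0.
have hn : K * n.+1%:R^-1 <= `|z| by near: n.
have tp : 0 < n.+1%:R^-1 `^ p :> R by rewrite powR_gt0.
rewrite powRN normrM ger0_norm ?invr_ge0 ?powR_ge0// ler_pdivrMl// mulrC.
apply: le_trans (far _ _ _ e1 t0 hn) _.
rewrite mulrAC ler_wpM2r ?(ltW tp)// mulrCA mulrC; apply: ltW; near: n.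
exact: (cvgr_lt 0 hcvg).
Unshelve. all: by end_near.
Qed.

Lemma dildiff_kernel0 e t : `|e| = 1 -> 0 < t ->
  t `^ (- p) * dildiff N (fun s => `|0 + s *: e| `^ p) t =
  2 * \prod_(j < N) (2 `^ p - 4 ^+ j).
Proof.
move=> e1 t0.
have gE s : `|0 + s *: e| `^ p = `|s| `^ p by rewrite add0r normrZ e1 mulr1.
rewrite (eq_dildiff _ _ gE) (@dildiff_eigen _ _ (2 `^ p)); last first.
  by move=> s; rewrite normrM ger0_norm// powRM.
rewrite normrN ger0_norm ?(ltW t0)// powRN; field.
by rewrite gt_eqF// powR_gt0.
Qed.

(** The exclusion of even integers acts here: a factor [2 ^ p - 4 ^+ j] vanishes only for
    [p = 2j]. *)
Lemma dildiff_kernel0_neq0 : (~ exists k : nat, p = (2 * k)%:R) ->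
  2 * \prod_(j < N) (2 `^ p - 4 ^+ j) != 0 :> R.
Proof.
move=> peven; rewrite mulf_neq0// prodf_seq_neq0; apply/allP => j _ /=.
have -> : 4 ^+ j = 2 `^ (2 * j)%:R :> R by rewrite powR_mulrn// exprM -(natrX R 2 2).
apply/negP; rewrite subr_eq0 => /eqP/(congr1 (@ln R)); rewrite !ln_powR.
have ln2 : ln 2 != 0 :> R by rewrite gt_eqF// ln_gt0// ltr1n.
by move=> /(mulIf ln2) h; apply: peven; exists j.
Qed.

End Hilbert.

(** * Borel sets and measurability of the distance *)

Section BorelMeasurability.
Variables (R : realType) (E : normedModType R).
Local Notation BE := (borel E).

Lemma open_borel (A : set E) : open A -> measurable (A : set BE).
Proof. exact: sub_sigma_algebra. Qed.

Lemma closed_borel (A : set E) : closed A -> measurable (A : set BE).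
Proof.
by rewrite -openC => /open_borel/measurableC; rewrite setCK.
Qed.

Lemma borel_set1 (x : E) : measurable ([set x] : set BE).
Proof.
apply: closed_borel; apply: accessible_closed_set1.
by apply: hausdorff_accessible; exact: norm_hausdorff.
Qed.

Lemma continuous_borel (f : E -> R) :
  continuous f -> measurable_fun setT (f : BE -> R).
Proof.
move=> /continuousP cf; apply: (measurability _ (RGenOpens.measurableE R)).
move=> _ [_ [a [b ->] <-]]; rewrite setTI; apply: open_borel; apply: cf.
exact: interval_open.
Qed.

Lemma continuous_borel_map (f : E -> E) :
  continuous f -> measurable_fun setT (f : BE -> BE).
Proof.
move=> /continuousP cf; apply: (@measurability _ _ BE BE setT f (@open E) erefl).
by move=> _ [B oB <-]; rewrite setTI; apply: open_borel; apply: cf.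
Qed.

Lemma continuous_dist (x : E) : continuous (fun y : E => distE y x).
Proof.
move=> y; rewrite /continuous_at /distE; apply: cvg_norm.
by apply: cvgB; [exact: cvg_id|exact: cvg_cst].
Qed.

Lemma measurable_dist (x : E) : measurable_fun setT (fun y : BE => distE y x).
Proof. exact: (continuous_borel (@continuous_dist x)). Qed.

Lemma distEC (x y : E) : distE x y = distE y x.
Proof. exact: distrC. Qed.

Lemma distE_triangle (y x z : E) : distE x z <= distE x y + distE y z.
Proof. exact: ler_distD. Qed.

Lemma dense_sequence : separable_space E -> exists d : nat -> E,
  forall (x : E) (r : R), 0 < r -> exists n, distE x (d n) < r.
Proof.
move=> [D [/pfcard_geP[D0|[f]] dD]].
  have : D !=set0.
    by have [||y [_ Dy]] := dD setT; [exists (0 : E)|exact: openT|exists y].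
  by rewrite D0 => -[].
exists f => x r r0.
have [||y [yx Dy]] := dD (ball x r); [by exists x; exact: ballxx|exact: ball_open|].
have [n _ ny] := @surj _ _ _ _ f y Dy.
by exists n; rewrite ny; move: yx; rewrite -ball_normE.
Qed.

(** Measurability is for the product sigma-algebra, so continuity does not suffice: by density,
    [|x - y| < r] holds exactly when [|x - d n| + |y - d n| < r] for some [n], a countable union. *)
Lemma measurable_dist2 : separable_space E ->
  measurable_fun setT (fun z : BE * BE => distE z.1 z.2).
Proof.
move=> /dense_sequence[d hd].
apply: (measurability _ (RGenInftyO.measurableE R)).
move=> _ [_ [r ->] <-]; rewrite setTI.
pose s n (z : BE * BE) := distE z.1 (d n) + distE z.2 (d n).
have ms n : measurable_fun setT (s n).
  apply: measurable_funD.
    exact: (measurableT_comp (measurable_dist (d n)) measurable_fst).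
  exact: (measurableT_comp (measurable_dist (d n)) measurable_snd).
rewrite [X in measurable X](_ : _ = \bigcup_n (s n @^-1` `]-oo, r[)).
  apply: bigcupT_measurable => n; rewrite -[X in measurable X]setTI.
  exact: ms.
apply/seteqP; split=> -[x y] /=; rewrite /preimage/= in_itv/=.
  move=> xyr; have e0 : 0 < (r - distE x y) / 2 by rewrite divr_gt0// subr_gt0.
  have [n xn] := hd x _ e0; exists n => //=; rewrite in_itv/= /s/=.
  by have := distE_triangle x y (d n); rewrite (distEC y x); lra.
move=> [n _] /=; rewrite in_itv/= /s/=; apply: le_lt_trans.
by rewrite (distEC y); exact: distE_triangle.
Qed.

End BorelMeasurability.

(** Convexity of the power at the midpoint of [2 * a] and [2 * b]. *)
Lemma powRD_le (R : realType) (p a b : R) : 1 <= p -> 0 <= a -> 0 <= b ->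
  (a + b) `^ p <= 2 `^ (p - 1) * (a `^ p + b `^ p).
Proof.
move=> p1 a0 b0.
have : (2^-1 * (2 * a) + 2^-1 * (2 * b)) `^ p <=
    2^-1 * (2 * a) `^ p + 2^-1 * (2 * b) `^ p.
  rewrite {2 4}(_ : 2^-1 = 1 - 2^-1); last by lra.
  by apply: (convex_powR p1 (Itv01 _ _)) => //=;
    rewrite ?inE/= ?in_itv/= ?mulr_ge0// ?invr_ge0// invf_le1 ?ler1n.
rewrite !mulrA mulVf// !mul1r => /le_trans; apply.
rewrite !powRM// !mulrA -powR_inv1// -powRD ?pnatr_eq0 ?implybT//.
by rewrite (addrC _ p) -mulrDr.
Qed.

(** * Image probabilities *)

Section Law.
Context d d' (T : measurableType d) (T' : measurableType d') (R : realType).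
Variables (mu : probability T R) (f : T -> T') (mf : measurable_fun setT f).

Definition law : probability T' R := distribution mu (mfun_Sub (mem_set mf)).

Lemma lawE A : law A = mu (f @^-1` A).
Proof. by []. Qed.

Lemma ge0_integral_law (g : T' -> \bar R) : measurable_fun setT g ->
  (forall y, (0 <= g y)%E) -> (\int[law]_y g y = \int[mu]_x g (f x))%E.
Proof. exact: (@ge0_integral_distribution _ _ _ _ _ mu (mfun_Sub (mem_set mf))). Qed.

End Law.

(** * Moments, couplings and the Wasserstein distance *)

Section Wasserstein.
Variables (R : realType) (E : normedModType R).
Hypothesis sepE : separable_space E.
Variable p : R.
Hypothesis p1 : 1 <= p.
Local Notation BE := (borel E).
Implicit Types (mu nu eta : probability BE R) (x y z : E).

Let p0 : 0 < p. Proof. exact: lt_le_trans p1. Qed.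

Lemma powR_distD y x z :
  distE x z `^ p <= 2 `^ (p - 1) * (distE x y `^ p + distE z y `^ p).
Proof.
rewrite (le_trans _ (powRD_le p1 _ _)) ?normr_ge0//.
rewrite ge0_ler_powR ?nnegrE ?addr_ge0 ?normr_ge0// ?(ltW p0)//.
by rewrite (distEC z); exact: distE_triangle.
Qed.

(** The quantity [(distE x y + distE z y) ^ p] is squeezed between the two equal sides, so the
    triangle inequality is an equality. *)
Lemma powR_distD_eq y x z :
  distE x z `^ p = 2 `^ (p - 1) * (distE x y `^ p + distE z y `^ p) ->
  distE x z = distE x y + distE z y.
Proof.
move=> h; apply: (powR_injective p0); rewrite ?nnegrE ?addr_ge0 ?normr_ge0//=.
apply/eqP; rewrite eq_le [in X in _ && X]h powRD_le ?normr_ge0// andbT.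
rewrite ge0_ler_powR ?nnegrE ?addr_ge0 ?normr_ge0// ?(ltW p0)//.
by rewrite (distEC z); exact: distE_triangle.
Qed.

Definition moment mu x : \bar R := (\int[mu]_y (distE y x `^ p)%:E)%E.

Lemma measurable_powR_dist x :
  measurable_fun setT (fun y : BE => (distE y x `^ p)%:E).
Proof.
apply/measurable_EFinP.
exact: (measurableT_comp (measurable_powR p) (measurable_dist x)).
Qed.

Lemma measurable_powR_dist2 :
  measurable_fun setT (fun z : BE * BE => (distE z.1 z.2 `^ p)%:E).
Proof.
apply/measurable_EFinP.
exact: (measurableT_comp (measurable_powR p) (measurable_dist2 sepE)).
Qed.

Lemma powR_ge0E (a b : R) : (0 <= (a `^ b)%:E)%E.
Proof. by rewrite lee_fin powR_ge0. Qed.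

Lemma moment_ge0 mu x : (0 <= moment mu x)%E.
Proof. by apply: integral_ge0 => y _; exact: powR_ge0E. Qed.

Lemma transport_cost_ge0 pi : (0 <= @transport_cost R E p pi)%E.
Proof. by apply: integral_ge0 => y _; exact: powR_ge0E. Qed.

Lemma integral_powR_distD (d : measure_display) (T : measurableType d)
    (m : probability T R) (f g h : T -> BE) :
  measurable_fun setT f -> measurable_fun setT g -> measurable_fun setT h ->
  (\int[m]_t (distE (f t) (g t) `^ p)%:E <= (2 `^ (p - 1))%:E *
    (\int[m]_t (distE (f t) (h t) `^ p)%:E +
     \int[m]_t (distE (g t) (h t) `^ p)%:E))%E.
Proof.
move=> mf mg mh.
have M (k l : T -> BE) : measurable_fun setT k -> measurable_fun setT l ->
    measurable_fun setT (fun t => (distE (k t) (l t) `^ p)%:E).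
  move=> mk ml.
  exact: (measurableT_comp measurable_powR_dist2 (measurable_fun_pair mk ml)).
rewrite -ge0_integralD//; do 1?[exact: M]; do 1?[by move=> *; exact: powR_ge0E].
rewrite -ge0_integralZl//; do 1?[by apply: emeasurable_funD; exact: M];
  do 1?[by move=> *; rewrite ?adde_ge0 ?powR_ge0E].
apply: ge0_le_integral => //.
- by move=> *; exact: powR_ge0E.
- exact: M.
- by apply: measurable_funeM; apply: emeasurable_funD; exact: M.
- by move=> t _; rewrite -EFinD -EFinM lee_fin powR_distD.
Qed.

Lemma moment_le mu x y :
  (moment mu y <= (2 `^ (p - 1))%:E * (moment mu x + (distE y x `^ p)%:E))%E.
Proof.
have := @integral_powR_distD _ _ mu id (cst (y : BE)) (cst (x : BE))
  (@measurable_id _ _ _) (measurable_cst _) (measurable_cst _).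
have -> : (\int[mu]_t (distE (cst (y : BE) t) (cst (x : BE) t) `^ p)%:E =
    (distE y x `^ p)%:E)%E.
  apply: (etrans (integral_cst mu measurableT (distE y x `^ p)%:E)).
  by rewrite [X in (_ * X)%E](@probability_setT _ _ _ mu) mule1.
by [].
Qed.

Lemma moment_lty mu x y : (moment mu x < +oo -> moment mu y < +oo)%E.
Proof.
move=> mx; apply: le_lt_trans (moment_le mu x y) _.
apply: lte_mul_pinfty; [exact: powR_ge0E|by []|].
by rewrite lte_add_pinfty ?mx ?ltry.
Qed.

Lemma Wp_moment mu x : Wp p mu <-> (moment mu x < +oo)%E.
Proof.
suff h : Wp p mu <-> (moment mu (0%R : E) < +oo)%E.
  by rewrite h; split; exact: moment_lty.
have -> : moment mu (0%R : E) = (\int[mu]_y (normE y `^ p)%:E)%E.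
  by apply: eq_integral => y _; rewrite /distE subr0.
by [].
Qed.

Lemma moment_fin mu x : Wp p mu -> moment mu x \is a fin_num.
Proof. by move=> /(Wp_moment mu x) h; rewrite ge0_fin_numE// moment_ge0. Qed.

Lemma coupling_integral1 mu nu pi (f : BE -> \bar R) : coupling mu nu pi ->
  measurable_fun setT f -> (forall y, (0 <= f y)%E) ->
  (\int[pi]_z f z.1 = \int[mu]_y f y)%E.
Proof.
move=> cpl mf f0; rewrite -(ge0_integral_law pi measurable_fst mf f0).
apply: eq_measure_integral => A mA _; have [h _] := cpl A mA.
apply: etrans h; rewrite (_ : A `*` setT = fst @^-1` A) //.
by apply/seteqP; split=> -[a b] //= [].
Qed.

Lemma swap_coupling mu nu pi : coupling mu nu pi ->
  coupling nu mu (law pi (@measurable_swap _ _ BE BE)).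
Proof.
move=> cpl A mA; have [h1 h2] := cpl A mA.
have e1 : unstable.swap @^-1` (A `*` [set: BE]) = [set: BE] `*` A.
  by apply/seteqP; split=> -[a b] /= [].
have e2 : unstable.swap @^-1` ([set: BE] `*` A) = A `*` [set: BE].
  by apply/seteqP; split=> -[a b] /= [].
split; first by apply: etrans h2; rewrite -e1.
by apply: etrans h1; rewrite -e2.
Qed.

Lemma coupling_integral2 mu nu pi (f : BE -> \bar R) : coupling mu nu pi ->
  measurable_fun setT f -> (forall y, (0 <= f y)%E) ->
  (\int[pi]_z f z.2 = \int[nu]_y f y)%E.
Proof.
move=> cpl mf f0.
apply: etrans (coupling_integral1 (swap_coupling cpl) mf f0).
apply: esym; apply: (ge0_integral_law pi (@measurable_swap _ _ BE BE)
  (g := fun z : BE * BE => f z.1)) => [|z]; last exact: f0.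
exact: (measurableT_comp mf measurable_fst).
Qed.

Lemma transport_cost_swap pi :
  transport_cost p (law pi (@measurable_swap _ _ BE BE)) = transport_cost p pi.
Proof.
apply: etrans (ge0_integral_law pi (@measurable_swap _ _ BE BE)
  measurable_powR_dist2 (fun=> powR_ge0E _ _)) _.
by apply: eq_integral => -[a b] _ /=; rewrite distEC.
Qed.

Lemma wasserstein_sym mu nu : wasserstein p mu nu = wasserstein p nu mu.
Proof.
congr (fine (ereal_inf _) `^ _); apply/seteqP; split=> _ [pi cpl <-];
  exists (law pi (@measurable_swap _ _ BE BE));
  by [exact: swap_coupling|rewrite transport_cost_swap].
Qed.

Lemma wasserstein_ge0 mu nu : 0 <= wasserstein p mu nu.
Proof. exact: powR_ge0. Qed.

Lemma wasserstein_powR mu nu : wasserstein p mu nu `^ p =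
  fine (ereal_inf [set transport_cost p pi | pi in [set pi | coupling mu nu pi]]).
Proof.
rewrite /wasserstein -powRrM mulVf ?gt_eqF// powRr1// fine_ge0//.
by apply: le_ereal_inf_tmp => _ [pi _ <-]; exact: transport_cost_ge0.
Qed.

Lemma wasserstein_powRK mu nu :
  (wasserstein p mu nu `^ p) `^ p^-1 = wasserstein p mu nu.
Proof.
have := wasserstein_ge0 mu nu; move: (wasserstein p mu nu) => w w0.
by rewrite -powRrM divff ?gt_eqF// powRr1.
Qed.

Lemma wasserstein_powR_le mu nu pi : coupling mu nu pi ->
  (transport_cost p pi < +oo)%E ->
  ((wasserstein p mu nu `^ p)%:E <= transport_cost p pi)%E.
Proof.
move=> cpl cfin.
have h0 : (0 <= ereal_inf [set transport_cost p pi | pi in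
    [set pi | coupling mu nu pi]])%E.
  by apply: le_ereal_inf_tmp => _ [pi' _ <-]; exact: transport_cost_ge0.
have hle : (ereal_inf [set transport_cost p pi | pi in
    [set pi | coupling mu nu pi]] <= transport_cost p pi)%E.
  by apply: ge_ereal_inf; exists (transport_cost p pi) => //; exists pi.
by rewrite wasserstein_powR fineK// ge0_fin_numE// (le_lt_trans hle).
Qed.

Lemma coupling_prod mu nu : coupling mu nu (mu \x nu)%E.
Proof.
move=> A mA; split.
  apply: etrans (product_measure1E mu nu mA measurableT) _.
  by rewrite [X in (_ * X)%E](@probability_setT _ _ _ nu) mule1.
apply: etrans (product_measure1E mu nu measurableT mA) _.
by rewrite [X in (X * _)%E](@probability_setT _ _ _ mu) mul1e.
Qed.

Lemma transport_cost_le mu nu pi x : coupling mu nu pi ->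
  (transport_cost p pi <=
    (2 `^ (p - 1))%:E * (moment mu x + moment nu x))%E.
Proof.
move=> cpl; have := @integral_powR_distD _ _ pi fst snd (cst (x : BE))
  measurable_fst measurable_snd (measurable_cst _).
move=> /le_trans; apply; rewrite le_eqVlt; apply/orP; left; apply/eqP.
congr (_ * (_ + _))%E; first exact: (coupling_integral1 cpl
  (measurable_powR_dist x) (fun=> powR_ge0E _ _)).
exact: (coupling_integral2 cpl (measurable_powR_dist x) (fun=> powR_ge0E _ _)).
Qed.

Lemma transport_cost_lty mu nu pi : Wp p mu -> Wp p nu -> coupling mu nu pi ->
  (transport_cost p pi < +oo)%E.
Proof.
move=> Wmu Wnu cpl; rewrite (le_lt_trans (transport_cost_le (0%R : E) cpl))//.
apply: lte_mul_pinfty; [exact: powR_ge0E|by []|].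
apply: lte_add_pinfty; first exact: (proj1 (Wp_moment mu _) Wmu).
exact: (proj1 (Wp_moment nu _) Wnu).
Qed.

Lemma wasserstein_coupling mu nu (c : R) : Wp p mu -> Wp p nu ->
  wasserstein p mu nu < c ->
  exists2 pi, coupling mu nu pi & (transport_cost p pi < (c `^ p)%:E)%E.
Proof.
move=> Wmu Wnu wc.
have c0 : 0 < c by apply: le_lt_trans wc; exact: wasserstein_ge0.
have h0 : (0 <= ereal_inf [set transport_cost p pi | pi in
    [set pi | coupling mu nu pi]])%E.
  by apply: le_ereal_inf_tmp => _ [pi' _ <-]; exact: transport_cost_ge0.
(* The product coupling has finite cost, so [fine] returns the true infimum rather than its default
   0. *)
have hfin : (ereal_inf [set transport_cost p pi | pi in
    [set pi | coupling mu nu pi]] < +oo)%E.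
  apply: le_lt_trans (transport_cost_lty Wmu Wnu (coupling_prod mu nu)).
  apply: ge_ereal_inf; exists (transport_cost p (mu \x nu)%E) => //.
  by exists (mu \x nu)%E => //; exact: coupling_prod.
have : (ereal_inf [set transport_cost p pi | pi in
    [set pi | coupling mu nu pi]] < (c `^ p)%:E)%E.
  rewrite -[X in (X < _)%E]fineK ?ge0_fin_numE// -wasserstein_powR lte_fin.
  by apply: gt0_ltr_powR; rewrite ?nnegrE ?wasserstein_ge0 ?(ltW c0).
by move=> /ereal_inf_lt[_ [pi cpl <-] h]; exists pi.
Qed.

(** The law of the pair [(f, g)] couples the two laws, and its cost is the given integral. *)
Lemma wasserstein_law_le (d : measure_display) (T : measurableType d)
    (m : probability T R) (f g : T -> BE) (mf : measurable_fun setT f)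
    (mg : measurable_fun setT g) (c : R) : 0 <= c ->
  (\int[m]_t (distE (f t) (g t) `^ p)%:E <= (c `^ p)%:E)%E ->
  wasserstein p (law m mf) (law m mg) <= c.
Proof.
move=> c0 hc; pose pi := law m (measurable_fun_pair mf mg).
have cpl : coupling (law m mf) (law m mg) pi.
  move=> A mA.
  have e1 : (fun t => (f t, g t)) @^-1` (A `*` [set: BE]) = f @^-1` A.
    by apply/seteqP; split=> t //= [].
  have e2 : (fun t => (f t, g t)) @^-1` ([set: BE] `*` A) = g @^-1` A.
    by apply/seteqP; split=> t //= [].
  by rewrite /pi /law/= /distribution /pushforward/= e1 e2.
have cost : transport_cost p pi = (\int[m]_t (distE (f t) (g t) `^ p)%:E)%E.
  exact: (ge0_integral_law m (measurable_fun_pair mf mg)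
    measurable_powR_dist2 (fun=> powR_ge0E _ _)).
have := @wasserstein_powR_le _ _ pi cpl; rewrite cost.
rewrite (le_lt_trans hc) ?ltry// => /(_ isT)/le_trans/(_ hc); rewrite lee_fin.
apply: contraTT; rewrite -!ltNge => cw.
by apply: gt0_ltr_powR; rewrite ?nnegrE ?wasserstein_ge0.
Qed.

End Wasserstein.

Lemma double_le_eq0 (R : realType) (w : R) : 0 <= w -> 2 * w <= w -> w = 0.
Proof. by move=> w0 w2; lra. Qed.

(** * Almost everywhere arguments for probabilities *)

Section AlmostEverywhere.
Context d (T : measurableType d) (R : realType) (m : probability T R).
Implicit Types (f g : T -> \bar R).

Lemma ge0_integral_eq_on1 (A : set T) f g : measurable A -> m A = 1%E ->
  measurable_fun setT f -> measurable_fun setT g ->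
  (forall t, (0 <= f t)%E) -> (forall t, (0 <= g t)%E) ->
  (forall t, A t -> f t = g t) -> (\int[m]_t f t = \int[m]_t g t)%E.
Proof.
move=> mA A1 mf mg f0 g0 fg; apply: ge0_ae_eq_integral => //.
exists (~` A); split; first exact: measurableC.
  by apply: etrans (probability_setC m mA) _; rewrite A1 subee.
by move=> t /= h At; apply: h => _; exact: fg.
Qed.

Lemma ge0_integral_eq0 f : measurable_fun setT f -> (forall t, (0 <= f t)%E) ->
  (\int[m]_t f t = 0)%E ->
  exists N : set T, [/\ measurable N, m N = 0%E & forall t, ~ N t -> f t = 0%E].
Proof.
move=> mf f0 if0.
have : (\int[m]_t `|f t| = 0)%E.
  by rewrite -[RHS]if0; apply: eq_integral => t _; rewrite gee0_abs.
move=> /(ae_eq_integral_abs m measurableT mf)[N [mN N0 sub]].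
exists N; split => // t Nt; apply: contrapT => ft; apply: Nt; apply: sub => /=.
by move=> h; apply: ft; exact: h.
Qed.

Lemma probability_not1 (A : set T) : measurable A -> m A <> 1%E -> m (~` A) <> 0%E.
Proof.
move=> mA A1 h; apply: A1; have := probability_setC m (measurableC mA).
by rewrite setCK => ->; rewrite h sube0.
Qed.

Lemma probability_sub1 (A B : set T) : measurable A -> measurable B ->
  A `<=` B -> m A = 1%E -> m B = 1%E.
Proof.
move=> mA mB AB A1; apply/eqP; rewrite eq_le probability_le1//= -A1.
by apply: le_measure; rewrite ?inE.
Qed.

Lemma probability_setC0 (A : set T) : measurable A -> m A = 0%E -> m (~` A) = 1%E.
Proof. by move=> mA A0; rewrite probability_setC// A0 sube0. Qed.

End AlmostEverywhere.

(** * Metric characterization of Dirac masses *)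

Section Dirac.
Variables (R : realType) (E : normedModType R).
Hypothesis sepE : separable_space E.
Variable p : R.
Hypothesis p1 : 1 <= p.
Local Notation BE := (borel E).
Local Notation W := (wasserstein p).
Implicit Types (mu nu eta : probability BE R) (x y a b : E).

Let p0 : 0 < p. Proof. exact: lt_le_trans p1. Qed.

Lemma dirac_set1 x : (\d_(x : BE) : probability BE R) [set x] = 1%E.
Proof. by apply: etrans (diracE _ _ _) _; rewrite mem_set. Qed.

Lemma ge0_integral_dirac mu x (f : BE -> \bar R) : mu [set x] = 1%E ->
  measurable_fun setT f -> (forall y, (0 <= f y)%E) -> (\int[mu]_y f y = f x)%E.
Proof.
move=> mux mf f0.
have -> : (\int[mu]_y f y = \int[mu]_y (cst (f x)) y)%E.
  apply: (ge0_integral_eq_on1 (borel_set1 x)) => //.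
    by move=> y; exact: f0.
  by move=> t ->.
rewrite integral_cst// [X in (_ * X)%E](@probability_setT _ _ _ mu).
exact: mule1.
Qed.

Lemma moment_dirac mu x y : mu [set x] = 1%E ->
  moment p mu y = (distE x y `^ p)%:E.
Proof.
move=> mux; apply: (ge0_integral_dirac mux (measurable_powR_dist p y)).
by move=> z; exact: powR_ge0E.
Qed.

Lemma Wp_dirac mu x : mu [set x] = 1%E -> Wp p mu.
Proof.
move=> mux; apply: (proj2 (Wp_moment sepE p1 mu x)).
by rewrite (moment_dirac _ mux) ltry.
Qed.

Lemma moment_eq0 mu x : moment p mu x = 0%E -> mu [set x] = 1%E.
Proof.
move=> /(ge0_integral_eq0 (measurable_powR_dist p x)
  (fun=> powR_ge0E _ _))[N [mN N0 hN]].
apply: (probability_sub1 (measurableC mN) (borel_set1 x)).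
  move=> y /hN -[] /eqP; rewrite powR_eq0 => /andP[/eqP h _] /=.
  by apply/eqP; rewrite -subr_eq0 -normr_eq0; apply/eqP.
exact: probability_setC0.
Qed.

(** Every such coupling gives full mass to the pairs with second coordinate [x]; all couplings cost
    the same and the infimum is explicit. *)
Lemma transport_cost_dirac nu mu pi x : mu [set x] = 1%E ->
  coupling nu mu pi -> transport_cost p pi = moment p nu x.
Proof.
move=> mux cpl; have mS : measurable ([set: BE] `*` [set x] : set (BE * BE)).
  by apply: measurableX => //; exact: borel_set1.
apply: etrans (coupling_integral1 cpl (measurable_powR_dist p x)
  (fun=> powR_ge0E _ _)).
apply: (ge0_integral_eq_on1 mS).
- by have [_ ->] := cpl _ (borel_set1 x).
- exact: measurable_powR_dist2.
- exact: (measurableT_comp (measurable_powR_dist p x) measurable_fst).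
- by move=> z; exact: powR_ge0E.
- by move=> z; exact: powR_ge0E.
- by move=> [s t] /= [_ ->].
Qed.

Lemma wasserstein_dirac nu mu x : mu [set x] = 1%E ->
  W nu mu `^ p = fine (moment p nu x).
Proof.
move=> mux; rewrite (wasserstein_powR p1); congr fine.
rewrite -[RHS](ereal_inf1 (moment p nu x)); congr ereal_inf.
apply/seteqP; split=> [_ [pi cpl <-]|_ ->].
  exact: transport_cost_dirac mux cpl.
exists (nu \x mu)%E; first exact: coupling_prod.
exact: transport_cost_dirac mux (coupling_prod nu mu).
Qed.

(** Couplings test their marginals on measurable sets only. *)
Lemma eq_wasserstein mu nu nu' : (forall A, measurable A -> nu A = nu' A) ->
  W mu nu = W mu nu'.
Proof.
move=> h; rewrite /wasserstein; congr (fine (ereal_inf _) `^ _).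
by apply/seteqP; split=> _ [pi cpl <-]; exists pi => // A mA;
  have [-> ->] := cpl A mA; rewrite h.
Qed.

(** In effect [nu] is a metric midpoint of [mu] and [eta]. The property mentions nothing but
    distances and membership in [Wp p], so isometric bijections preserve it. *)
Definition extends_geodesics mu := forall nu, Wp p nu ->
  exists2 eta, Wp p eta & 2 * W nu mu <= W eta mu /\ W eta nu <= W nu mu.

(** The dilation [f] doubles distances to [x], and it moves each [y] by exactly [|y - x|]. *)
Lemma dirac_extends mu x : mu [set x] = 1%E -> extends_geodesics mu.
Proof.
move=> mux nu Wnu; pose f y : E := (2 : R) *: y - x.
have mf : measurable_fun setT (f : BE -> BE).
  apply: continuous_borel_map => y; apply: cvgB; last exact: cvg_cst.
  by apply: cvgZr; exact: cvg_id.
have momE : moment p (law nu mf) x = ((2 `^ p)%:E * moment p nu x)%E.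
  apply: etrans (ge0_integralZl nu measurableT (measurable_powR_dist p x)
    (fun _ _ => powR_ge0E _ _) (powR_ge0E 2 p)).
  apply: etrans (ge0_integral_law nu mf (measurable_powR_dist p x)
    (fun=> powR_ge0E _ _)) _.
  apply: eq_integral => y _; rewrite -EFinM -powRM// ?normr_ge0//.
  rewrite /distE (_ : f y - x = (2 : R) *: (y - x)) ?normrZ ?ger0_norm//.
  by rewrite /f scalerBr [_ *: x]scaler_nat mulr2n opprD addrA.
have nuf := moment_fin sepE p1 x Wnu.
have Weta : Wp p (law nu mf).
  apply: (proj2 (Wp_moment sepE p1 _ x)); rewrite momE.
  by rewrite -(fineK nuf) -EFinM ltry.
exists (law nu mf) => //; split.
  rewrite leNgt; apply/negP => /(gt0_ltr_powR p0).
  rewrite !nnegrE ?mulr_ge0 ?wasserstein_ge0//= => /(_ isT isT).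
  rewrite powRM ?wasserstein_ge0// !(wasserstein_dirac _ mux) momE fineM//.
  by rewrite ltxx.
rewrite (@eq_wasserstein _ _ (law nu (@measurable_id _ BE setT)))//.
apply: (wasserstein_law_le sepE p1); first exact: wasserstein_ge0.
rewrite (wasserstein_dirac _ mux) fineK//.
rewrite le_eqVlt; apply/orP; left; apply/eqP; apply: eq_integral => y _.
rewrite /f /distE /= scaler_nat mulr2n.
by rewrite addrAC addrK.
Qed.

Definition support mu : set E :=
  [set x | forall r : R, 0 < r -> mu [set y | distE y x < r] <> 0%E].

Lemma ball_borel x (r : R) : measurable ([set y | distE y x < r] : set BE).
Proof.
rewrite (_ : [set y | _] = (fun y => distE y x) @^-1` [set t | t < r])//.
by apply: open_borel; apply: open_comp => [y _|];
  [exact: continuous_dist|exact: open_lt].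
Qed.

(** [N] is the union of the null balls with centre in a dense sequence and radius [1 / (k + 1)]; a
    null ball about [x] contains one of these that contains [x]. *)
Lemma support_null mu : exists N : set BE,
  [/\ measurable N, mu N = 0%E & forall x, ~ N x -> support mu x].
Proof.
have [e he] := dense_sequence sepE.
pose B n k : set BE := [set y | distE y (e n) < k.+1%:R^-1].
pose B' n k := if `[< mu (B n k) = 0%E >] then B n k else set0.
have mB' n k : measurable (B' n k).
  by rewrite /B'; case: asboolP => _; [exact: ball_borel|exact: measurable0].
have B'0 n k : mu (B' n k) = 0%E.
  by rewrite /B'; case: asboolP => //= _; exact: measure0.
have mN : measurable (\bigcup_n \bigcup_k B' n k).
  by apply: bigcupT_measurable => n; exact: bigcupT_measurable.
exists (\bigcup_n \bigcup_k B' n k); split => //.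
  apply/negligibleP => //; apply: negligible_bigcup => n.
  by apply: negligible_bigcup => k; apply/negligibleP; [exact: mB'|exact: B'0].
move=> x Nx r r0 mu0; apply: Nx.
have r20 : 0 < r / 2 by rewrite divr_gt0.
have [k _ hk] := near_infty_natSinv_lt (PosNum r20).
have {hk} kr : k.+1%:R^-1 < r / 2 := hk k (leqnn k).
have [n xn] := he x k.+1%:R^-1 ltac:(by rewrite invr_gt0).
exists n => //; exists k => //; rewrite /B'; case: asboolP => //=.
case; apply: subset_measure0 mu0; [exact: ball_borel|exact: ball_borel|].
move=> y yn'; have {yn'} yn : distE y (e n) < k.+1%:R^-1 := yn'.
apply: (le_lt_trans (distE_triangle (e n) y x)).
rewrite [r]splitr ltrD//; first exact: lt_trans yn kr.
by rewrite distEC; exact: lt_trans xn kr.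
Qed.

Lemma support_dirac mu : (forall a b, support mu a -> support mu b -> a = b) ->
  exists x, mu [set x] = 1%E.
Proof.
move=> sub; have [N [mN N0 Ns]] := support_null mu.
have NC := probability_setC0 mN N0.
have [a Na] : exists a, ~ N a.
  apply: contrapT => h; have NT : N = setT.
    by apply/seteqP; split=> // x _; apply: contrapT => Nx; apply: h; exists x.
  by move: N0; rewrite NT (@probability_setT _ _ _ mu) => /eqP; rewrite onee_eq0.
exists a; apply: (probability_sub1 (measurableC mN) (borel_set1 a)) => //.
by move=> b Nb /=; apply: sub; exact: Ns.
Qed.

(** Both sides are continuous in [x]: a strict inequality at [a] would persist on the ball whose
    radius is half the gap, and that ball is not null. *)
Lemma aligned_support mu y z a (N : set BE) : measurable N -> mu N = 0%E ->
  (forall x, ~ N x -> distE z x = distE z y + distE x y) ->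
  support mu a -> distE z a = distE z y + distE a y.
Proof.
move=> mN N0 hN sa; apply/eqP; rewrite eq_le (distEC a) distE_triangle/= leNgt.
apply/negP => lt; pose r := (distE z y + distE y a - distE z a) / 2.
have r0 : 0 < r by rewrite divr_gt0// subr_gt0.
apply: (sa r r0); apply: subset_measure0 N0 => //; first exact: ball_borel.
move=> x /= xa; apply: contrapT => /hN.
have := distE_triangle a z x; have := distE_triangle x a y.
by rewrite (distEC a x) (distEC a y); rewrite /r in xa; lra.
Qed.

Variable ip : E -> E -> R.
Hypothesis ipN : inner_product_inducing_norm ip.

(** With [w = z - y] and [v = a - y], both [|w - v|] and [|w + v|] equal [|w| + |v|]; the
    parallelogram law then gives [|w| * |v| = 0]. *)
Lemma aligned_midpoint a b z : let y := (2 : R)^-1 *: (a + b) in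
  distE z a = distE z y + distE a y -> distE z b = distE z y + distE b y ->
  a = b \/ z = y.
Proof.
move=> y; pose v := a - y; pose w := z - y.
have yy : y + y = a + b by rewrite -scalerDl -[_^-1]div1r -splitr scale1r.
have bv : b - y = - v.
  by rewrite /v opprB; apply/eqP; rewrite subr_eq addrAC yy addrAC addrN add0r.
have za : z - a = w - v by rewrite /w /v opprB addrA subrK.
have zb : z - b = w + v.
  by rewrite -[v]opprK -bv /w opprB addrA subrK.
rewrite /distE -/w -/v za zb bv normrN => h1 h2.
have := parallelogram ipN w v; rewrite h1 h2 => h.
have /eqP : `|w| * `|v| = 0 by lra.
rewrite mulf_eq0 !normr_eq0 => /orP[|]; rewrite subr_eq0 => /eqP; first by right.
move=> ay; left; move: bv; rewrite /v ay subrr oppr0 => /eqP.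
by rewrite subr_eq0 => /eqP.
Qed.

(* The hypotheses force equality in [|z - x|^p <= 2^(p-1) (|z - y|^p + |x - y|^p)]
   almost everywhere for the product coupling. *)
Lemma prod_defect_eq0 eta mu y : Wp p eta -> Wp p mu ->
  2 * fine (moment p mu y) `^ p^-1 <= W eta mu ->
  (moment p eta y <= moment p mu y)%E ->
  exists N : set (BE * BE), [/\ measurable N, (eta \x mu)%E N = 0%E &
    forall z x, ~ N (z, x) -> distE z x = distE z y + distE x y].
Proof.
move=> Weta Wmu far near; pose c : R := 2 `^ (p - 1).
have c0 : 0 <= c by exact: powR_ge0.
pose F (t : BE * BE) := c * (distE t.1 y `^ p + distE t.2 y `^ p).
pose G (t : BE * BE) := distE t.1 t.2 `^ p.
pose H (t : BE * BE) := F t - G t.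
have mG : measurable_fun setT G.
  exact: (measurableT_comp (measurable_powR p) (measurable_dist2 sepE)).
have mF1 : measurable_fun setT (fun t : BE * BE => distE t.1 y `^ p).
  exact: (measurableT_comp (measurable_powR p)
    (measurableT_comp (measurable_dist y) measurable_fst)).
have mF2 : measurable_fun setT (fun t : BE * BE => distE t.2 y `^ p).
  exact: (measurableT_comp (measurable_powR p)
    (measurableT_comp (measurable_dist y) measurable_snd)).
have mF : measurable_fun setT F.
  by apply: measurable_funM; [exact: measurable_cst|exact: measurable_funD].
have mH : measurable_fun setT (fun t => (H t)%:E).
  by apply/measurable_EFinP; exact: measurable_funB.
have H0 t : (0 <= (H t)%:E)%E by rewrite lee_fin subr_ge0; exact: powR_distD.
have cpl := coupling_prod eta mu.
pose M := fine (moment p mu y).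
have ME : moment p mu y = M%:E by rewrite fineK// moment_fin.
have M0 : 0 <= M by rewrite fine_ge0// moment_ge0.
(* The integral of [F] is [2 ^ (p - 1)] times the sum of two moments at [y], each at most [M]. *)
have intF : (\int[(eta \x mu)%E]_t (F t)%:E <= (2 `^ p * M)%:E)%E.
  have -> : (\int[(eta \x mu)%E]_t (F t)%:E =
      c%:E * (moment p eta y + moment p mu y))%E.
    have E1 : (\int[(eta \x mu)%E]_t (distE t.1 y `^ p)%:E = moment p eta y)%E.
      exact: (coupling_integral1 cpl (measurable_powR_dist p y)
        (fun=> powR_ge0E _ _)).
    have E2 : (\int[(eta \x mu)%E]_t (distE t.2 y `^ p)%:E = moment p mu y)%E.
      exact: (coupling_integral2 cpl (measurable_powR_dist p y)
        (fun=> powR_ge0E _ _)).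
    rewrite -E1 -E2.
    rewrite -ge0_integralD//=; do 1?[by move=> t _; exact: powR_ge0E];
      do 1?[exact/measurable_EFinP].
    rewrite -ge0_integralZl//.
    - by apply: emeasurable_funD; exact/measurable_EFinP.
    - by move=> t _; rewrite adde_ge0// powR_ge0E.
  apply: (@le_trans _ _ (c%:E * (moment p mu y + moment p mu y))%E).
    by rewrite lee_pmul2l// ?lte_fin ?powR_gt0// leeD2r.
  rewrite ME -EFinD -EFinM lee_fin -mulr2n -[M *+ 2]mulr_natl mulrA ler_wpM2r//.
  by rewrite mulrC /c mulr_powRB1.
(* The product coupling costs at least [W eta mu ^ p]. With the bound on [F], this forces the
   nonnegative defect [H] to integrate to 0. *)
have intG : ((2 `^ p * M)%:E <= \int[(eta \x mu)%E]_t (G t)%:E)%E.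
  apply: (@le_trans _ _ (W eta mu `^ p)%:E).
    rewrite lee_fin; apply: (@le_trans _ _ ((2 * M `^ p^-1) `^ p)).
      by rewrite powRM ?powR_ge0// -powRrM mulVf ?gt_eqF// powRr1.
    by apply: ge0_ler_powR; rewrite ?(ltW p0) ?nnegrE ?mulr_ge0 ?powR_ge0.
  exact: (wasserstein_powR_le p1 cpl (transport_cost_lty sepE p1 Weta Wmu cpl)).
have intH : (\int[(eta \x mu)%E]_t (H t)%:E = 0)%E.
  have D : (\int[(eta \x mu)%E]_t (F t)%:E = \int[(eta \x mu)%E]_t (G t)%:E +
      \int[(eta \x mu)%E]_t (H t)%:E)%E.
    rewrite -ge0_integralD//; last 2 first.
    - by move=> t _; exact: powR_ge0E.
    - exact/measurable_EFinP.
    by apply: eq_integral => t _; rewrite -EFinD /H addrC subrK.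
  have Gfin : (\int[(eta \x mu)%E]_t (G t)%:E)%E \is a fin_num.
    rewrite ge0_fin_numE; first exact: (transport_cost_lty sepE p1 Weta Wmu cpl).
    exact: transport_cost_ge0.
  apply/eqP; rewrite eq_le integral_ge0// andbT -(leeD2lE _ _ Gfin) -D adde0.
  exact: le_trans intF intG.
have [N [mN N0 hN]] := ge0_integral_eq0 mH H0 intH.
exists N; split => // z x /hN -[] /eqP; rewrite subr_eq0 eq_sym => /eqP.
exact: (@powR_distD_eq _ _ p p1 y z x).
Qed.

Lemma extends_dirac mu : Wp p mu -> extends_geodesics mu ->
  exists x, mu [set x] = 1%E.
Proof.
move=> Wmu ext; apply: contrapT => nodirac.
suff : exists x, mu [set x] = 1%E by [].
apply: support_dirac => a b sa sb; apply: contrapT => ab; apply: nodirac.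
pose y := (2 : R)^-1 *: (a + b); exists y.
have [nu nuy] : exists nu : probability BE R, nu [set y] = 1%E.
  by exists (\d_(y : BE)); exact: dirac_set1.
have [eta Weta [far near]] := ext nu (Wp_dirac nuy).
have muy : W nu mu `^ p = fine (moment p mu y).
  by rewrite (wasserstein_sym sepE) (wasserstein_dirac _ nuy).
have muy' : fine (moment p mu y) `^ p^-1 = W nu mu.
  by rewrite -muy (wasserstein_powRK p1).
have near' : (moment p eta y <= moment p mu y)%E.
  rewrite -(fineK (moment_fin sepE p1 y Weta)) -(fineK (moment_fin sepE p1 y Wmu)).
  rewrite lee_fin -(wasserstein_dirac eta nuy) -muy.
  apply: ge0_ler_powR near; first exact: ltW; exact: wasserstein_ge0.
have far' : 2 * fine (moment p mu y) `^ p^-1 <= W eta mu by rewrite muy'.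
have [N [mN N0 hN]] := prod_defect_eq0 Weta Wmu far' near'.
(* If [eta] is the Dirac mass at [y], then [W eta mu = W nu mu]; the overshoot makes this distance
   0, so [mu] sits at [y]. *)
have [etay|etay] := pselect (eta [set y] = 1%E).
  have e : W eta mu = W nu mu.
    rewrite -[LHS](wasserstein_powRK p1) (wasserstein_sym sepE).
    by rewrite (wasserstein_dirac _ etay).
  apply: moment_eq0; rewrite -(fineK (moment_fin sepE p1 y Wmu)).
  suff -> : fine (moment p mu y) = 0 by [].
  move: far muy; rewrite e; have := wasserstein_ge0 p nu mu.
  move: (W nu mu) => w w0 /(double_le_eq0 w0) -> <-.
  by rewrite powR0 ?gt_eqF.
have mxs : measurable_fun setT (fun z : BE => mu (xsection N z)).
  exact: (measurable_fun_xsection mu mN).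
have [N' [mN' N'0 hN']] := ge0_integral_eq0 mxs (fun=> measure_ge0 _ _) N0.
(* Otherwise some [z <> y] avoids the null set [N'], and its section of [N] is [mu]-null. *)
have [z [Nz zy]] : exists z, ~ N' z /\ z <> y.
  apply: contrapT => h; apply: (probability_not1 (borel_set1 y) etay).
  apply: subset_measure0 N'0 => //; first exact: measurableC (borel_set1 y).
  by move=> z zy; apply: contrapT => Nz; apply: h; exists z.
have mxN : measurable (xsection N z) by exact: measurable_xsection.
have al x : support mu x -> distE z x = distE z y + distE x y.
  apply: (aligned_support mxN (hN' z Nz)) => t /= Nt.
  by apply: hN => h; apply: Nt; rewrite /xsection/= inE.
by have [] := aligned_midpoint (al a sa) (al b sb).
Qed.

End Dirac.

(** A dilation difference is a finite linear combination of values, so it commutes with the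
    integral. *)
Lemma Rintegral_dildiff (d : measure_display) (T : measurableType d) (R : realType)
    (m : probability T R) (G : R -> T -> R) (k : nat) (t : R) :
  (forall s, m.-integrable setT (EFin \o G s)) ->
  m.-integrable setT (EFin \o (fun y => dildiff k (G ^~ y) t)) /\
  (\int[m]_y dildiff k (G ^~ y) t)%R = dildiff k (fun s => (\int[m]_y G s y)%R) t.
Proof.
move=> iG; elim: k t => [|k IH] t /=.
  split; last by rewrite RintegralD.
  exact: (integrableD measurableT (iG t) (iG (- t))).
have [i1 e1] := IH (2 * t); have [i2 e2] := IH t.
have i3 : m.-integrable setT (EFin \o (fun y => 4 ^+ k * dildiff k (G ^~ y) t)).
  exact: (integrableZl measurableT (4 ^+ k) i2).
split; first exact: (integrableB measurableT i1 i3).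
by rewrite RintegralB// RintegralZl// e1 e2.
Qed.

(** * Recovering atoms from the potential *)

Section Potential.
Variables (R : realType) (E : normedModType R) (ip : E -> E -> R).
Hypotheses (ipN : inner_product_inducing_norm ip) (sepE : separable_space E).
Variable p : R.
Hypotheses (p1 : 1 <= p) (peven : ~ exists k : nat, p = (2 * k)%:R).
Local Notation BE := (borel E).
Implicit Types (mu nu : probability BE R) (x y e : E).

Lemma powR_dist_integrable mu x : Wp p mu ->
  mu.-integrable setT (EFin \o (fun y : BE => distE y x `^ p)).
Proof.
move=> Wmu; apply/integrableP; split; first exact: measurable_powR_dist.
have := proj1 (Wp_moment sepE p1 mu x) Wmu.
rewrite /moment; under eq_integral => y _ do
  rewrite -[X in X%:E]ger0_norm ?powR_ge0// -abse_EFin.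
by [].
Qed.

(** Dominated convergence: the dilation difference passes under the integral, where the rescaled
    kernel is bounded and tends to a constant times the indicator of [x]. *)
Lemma atom_cvg mu x e (N : nat) : p + 1 <= N%:R -> Wp p mu -> `|e| = 1 ->
  (fun n : nat => (n.+1%:R^-1 `^ (- p) * dildiff N
      (fun s => fine (moment p mu (x + s *: e))) n.+1%:R^-1)%:E) @ \oo -->
  ((2 * \prod_(j < N) (2 `^ p - 4 ^+ j))%:E * mu [set x])%E.
Proof.
move=> pN Wmu e1; set c := 2 * _.
pose G s (y : BE) := distE y (x + s *: e) `^ p.
have GE y s : G s y = `|x - y + s *: e| `^ p.
  by rewrite /G distEC /distE addrAC.
have iG s : mu.-integrable setT (EFin \o G s) by exact: powR_dist_integrable.
pose h n (y : BE) := n.+1%:R^-1 `^ (- p) * dildiff N (G ^~ y) (n.+1%:R^-1 : R).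
have ih n : mu.-integrable setT (EFin \o h n).
  have [i _] := Rintegral_dildiff N n.+1%:R^-1 iG.
  exact: (integrableZl measurableT (n.+1%:R^-1 `^ (- p)) i).
have hE n : (\int[mu]_y (h n y)%:E = (n.+1%:R^-1 `^ (- p) * dildiff N
      (fun s => fine (moment p mu (x + s *: e))) n.+1%:R^-1)%:E)%E.
  have [i ei] := Rintegral_dildiff N n.+1%:R^-1 iG.
  rewrite -(fineK (integrable_fin_num measurableT (ih n))); congr EFin.
  by rewrite -ei -RintegralZl.
have [C C0 hC] := dildiff_kernel_bounded ipN p1 pN.
have ic : mu.-integrable setT (cst C%:E).
  exact: finite_measure_integrable_cst.
have mf : measurable_fun setT (fun y : BE => (c * \1_[set x] y)%:E).
  apply/measurable_EFinP; apply: measurable_funM; first exact: measurable_cst.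
  by apply: measurable_indic; exact: borel_set1.
have cvgR (y : BE) : h n y @[n --> \oo] --> c * \1_[set x] y.
  have [->|yx] := eqVneq (y : E) x.
    rewrite indicE mem_set// mulr1.
    have -> : (fun n => h n x) = cst c; last exact: cvg_cst.
    apply/funext => n; rewrite /h (eq_dildiff _ _ (GE x)) subrr.
    by rewrite (dildiff_kernel0 _ _ e1)// invr_gt0.
  rewrite indicE memNset ?mulr0; last by move=> /= h0; move: yx; rewrite h0 eqxx.
  have xy : x - y != 0 by rewrite subr_eq0 eq_sym.
  have -> : (fun n => h n y) = (fun n => n.+1%:R^-1 `^ (- p) *
      dildiff N (fun s => `|x - y + s *: e| `^ p) (n.+1%:R^-1 : R)).
    by apply/funext => n; rewrite /h (eq_dildiff _ _ (GE y)).
  exact: (dildiff_kernel_cvg ipN p1 pN e1 xy).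
have cvgh (y : BE) : (h n y)%:E @[n --> \oo] --> (c * \1_[set x] y)%:E.
  by apply: cvg_EFin; [exact: nearW|exact: cvgR].
have hb : \forall y \ae mu, forall n, setT y -> (`|(h n y)%:E| <= cst C%:E y)%E.
  apply: aeW => y n _; rewrite abse_EFin lee_fin /h (eq_dildiff _ _ (GE y)).
  by apply: hC => //; rewrite invr_gt0.
have hcv : \forall y \ae mu, setT y ->
    (h n y)%:E @[n --> \oo] --> (c * \1_[set x] y)%:E.
  by apply: aeW => y _; exact: cvgh.
have [_ _] := @dominated_convergence _ _ _ mu setT measurableT
  (fun n (y : BE) => (h n y)%:E)
  (fun y : BE => (c * \1_[set x] y)%:E) (cst C%:E)
  (fun n => measurable_int _ (ih n)) mf hcv ic hb.
have -> : (\int[mu]_y (c * \1_[set x] y)%:E = c%:E * mu [set x])%E.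
  under eq_integral do rewrite EFinM.
  rewrite integralZl//; last first.
    by apply: integrable_indic; exact: borel_set1.
  by rewrite integral_indic// ?setIT//; exact: borel_set1.
by under eq_fun do rewrite hE.
Qed.

Lemma potential_atoms mu nu e : `|e| = 1 -> Wp p mu -> Wp p nu ->
  (forall x, moment p mu x = moment p nu x) ->
  forall x, mu [set x] = nu [set x].
Proof.
move=> e1 Wmu Wnu mom x.
have [N pN] : exists N : nat, p + 1 <= N%:R.
  by exists (Num.truncn (p + 1)).+1; apply: ltW; exact: truncnS_gt.
have c0 := dildiff_kernel0_neq0 N peven.
have cmu := atom_cvg (x := x) pN Wmu e1; have cnu := atom_cvg (x := x) pN Wnu e1.
have mE : (fun s => fine (moment p mu (x + s *: e))) =
    (fun s => fine (moment p nu (x + s *: e))) by apply/funext => s; rewrite mom.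
rewrite mE in cmu; move: (2 * _) c0 cmu cnu => c c0 cmu cnu.
have cE : (c%:E * mu [set x] = c%:E * nu [set x])%E.
  by apply: cvg_unique cmu cnu; exact: ereal_hausdorff.
by rewrite -[LHS]mul1e -[RHS]mul1e -(mulVf c0) EFinM -!muleA cE.
Qed.

End Potential.

(** * Atomic approximation and passage to the limit *)

Section Approximation.
Variables (R : realType) (E : normedModType R).
Hypothesis sepE : separable_space E.
Variable p : R.
Hypothesis p1 : 1 <= p.
Local Notation BE := (borel E).
Local Notation W := (wasserstein p).
Implicit Types (mu nu rho sigma : probability BE R) (x y : E) (C : set BE).

Let p0 : 0 < p. Proof. exact: lt_le_trans p1. Qed.

Lemma range_borel (e : nat -> E) : measurable (range e : set BE).
Proof.
have -> : range e = \bigcup_n [set e n].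
  by apply/seteqP; split=> [_ [n _ <-]|y [n _ ->]]; exists n.
by apply: bigcupT_measurable => n; exact: borel_set1.
Qed.

Lemma probability_setI1 mu (A D : set BE) : measurable A -> measurable D ->
  mu D = 1%E -> mu (A `&` D) = mu A.
Proof.
move=> mA mD D1.
have D0 : mu (~` D) = 0%E by rewrite (probability_setC mu mD) D1 subee.
have AD0 : mu (A `\` D) = 0%E.
  by apply: subset_measure0 D0; [exact: measurableD|exact: measurableC|move=> y []].
apply/esym/(etrans (measureDI mu mA mD)).
by rewrite [X in (X + _)%E]AD0 add0e.
Qed.

(** Only [mu] is assumed to be carried by [range e]. Summing equal atoms gives [nu (range e) = 1] as
    well. *)
Lemma eq_probability_atoms mu nu (e : nat -> E) :
  (forall x, mu [set x] = nu [set x]) -> mu (range e) = 1%E ->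
  forall A, measurable A -> mu A = nu A.
Proof.
move=> atoms mue.
have eqI (A : set BE) : measurable A -> mu (A `&` range e) = nu (A `&` range e).
  move=> mA; pose F n : set BE := A `&` [set e n].
  have mF n : measurable (F n) by apply: measurableI => //; exact: borel_set1.
  (* The sequence [e] may repeat values; [seqDU] keeps each atom once. *)
  have -> : A `&` range e = \bigcup_n seqDU F n.
    rewrite -seqDU_bigcup_eq; apply/seteqP; split.
      by move=> y [Ay [n _ ny]]; exists n.
    by move=> y [n _ [Ay yn]]; split=> //; exists n.
  rewrite !measure_bigcup//; do 1?[by move=> n _; exact: seqDU_measurable].
  apply: eq_eseriesr => n _.
  have [->|/set0P[y yF]] := eqVneq (seqDU F n) set0; first by rewrite !measure0.
  have FE : seqDU F n = [set e n].
    have [[Ay ye] _] := yF; apply/seteqP; split; first by move=> z [[_ ->]].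
    by move=> z ->; rewrite -ye.
  by rewrite FE; exact: atoms.
have nue : nu (range e) = 1%E.
  by rewrite -[range e]setTI -eqI// setTI.
move=> A mA.
by rewrite -(probability_setI1 mA (range_borel e) mue) eqI//
  probability_setI1//; exact: range_borel.
Qed.

(** [f] selects the first term of a dense sequence at distance less than [r]. Its level set of index
    [n] is a ball minus the earlier balls, hence measurable. *)
Lemma countable_range_approx (r : R) : 0 < r -> exists (f : BE -> BE) (e : nat -> E),
  [/\ measurable_fun setT f, (forall x, distE (f x) x < r) &
      (forall x, range e (f x))].
Proof.
move=> r0; have [e he] := dense_sequence sepE.
pose k (x : BE) := ex_minn (he x r r0).
have kP x : distE x (e (k x)) < r by rewrite /k; case: ex_minnP.
pose B n : set BE := [set y | distE y (e n) < r].
have kE n : [set x | k x = n] = seqDU B n.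
  rewrite /seqDU -bigcup_mkord; apply/seteqP; split=> [x <-|x [/= xn h]].
    rewrite /k; case: ex_minnP => m xm mmin; split => // -[i /= im xi].
    by have := mmin i xi; rewrite leqNgt im.
  rewrite /= /k; case: ex_minnP => m xm mmin; apply/eqP; rewrite eqn_leq mmin//=.
  by rewrite leqNgt; apply/negP => mn; apply: h; exists m.
exists (fun x => e (k x)), e; split; last by move=> x; exists (k x).
  move=> _ A mA; rewrite setTI.
  rewrite [X in measurable X](_ : _ =
    \bigcup_(n in [set n | A (e n)]) [set x | k x = n]).
    apply: bigcup_measurable => n _; rewrite kE.
    by apply: seqDU_measurable => i; exact: ball_borel.
  by apply/seteqP; split=> [x Ax|x [n /= An xn]]; [exists (k x)|rewrite /preimage/= xn].
by move=> x; rewrite distEC.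
Qed.

Lemma integral_powR_dist_small mu (f g : BE -> BE) (r : R) : 0 <= r ->
  measurable_fun setT f -> measurable_fun setT g ->
  (forall x, distE (f x) (g x) <= r) ->
  (\int[mu]_x (distE (f x) (g x) `^ p)%:E <= (r `^ p)%:E)%E.
Proof.
move=> r0 mf mg fr; have -> : (r `^ p)%:E = (\int[mu]_x (cst (r `^ p)%:E) x)%E.
  rewrite integral_cst// [X in (_ * X)%E](@probability_setT _ _ _ mu).
  by rewrite mule1.
apply: ge0_le_integral => //.
- by move=> x _; exact: powR_ge0E.
- exact: (measurableT_comp (measurable_powR_dist2 sepE p)
    (measurable_fun_pair mf mg)).
- move=> x _; rewrite lee_fin ge0_ler_powR ?nnegrE ?(ltW p0)//.
  exact: normr_ge0.
Qed.

Lemma Wp_law mu (f : BE -> BE) (mf : measurable_fun setT f) (r : R) :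
  (forall x, distE (f x) x <= r) -> Wp p mu -> Wp p (law mu mf).
Proof.
move=> fr Wmu; have r0 : 0 <= r := le_trans (normr_ge0 _) (fr 0).
apply: (proj2 (Wp_moment sepE p1 _ (0%R : E))).
have -> : moment p (law mu mf) (0%R : E) =
    (\int[mu]_x (distE (f x) (cst (0%R : E) x) `^ p)%:E)%E.
  exact: (ge0_integral_law mu mf (measurable_powR_dist p 0)
    (fun=> powR_ge0E _ _)).
apply: (le_lt_trans (integral_powR_distD sepE p1 mu mf (measurable_cst _)
  (@measurable_id _ BE setT))).
apply: lte_mul_pinfty; [exact: powR_ge0E|by []|apply: lte_add_pinfty].
  have small := @integral_powR_dist_small mu f id r r0 mf
    (@measurable_id _ BE setT) fr.
  exact: le_lt_trans small (ltry _).
have <- : moment p mu (0%R : E) =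
    (\int[mu]_x (distE (cst (0%R : E) x) x `^ p)%:E)%E.
  by apply: eq_integral => x _; rewrite distEC.
exact: (proj1 (Wp_moment sepE p1 mu _) Wmu).
Qed.

Definition enlarge C (r : R) : set BE := [set y | exists2 c, C c & distE y c < r].

(** A union of open balls is open, whatever [C] is. *)
Lemma enlarge_borel C (r : R) : measurable (enlarge C r).
Proof.
have -> : enlarge C r = \bigcup_(c in C) [set y | distE y c < r].
  by apply/seteqP; split=> [y [c]|y [c]]; exists c.
apply: open_borel; apply: bigcup_open => c _.
by apply: (open_comp (f := fun y : E => distE y c) (D := [set t | t < r]));
  [move=> y _; exact: continuous_dist|exact: open_lt].
Qed.

(** Some coupling costs less than [(r * r) ^ p]; by Markov, pairs at distance at least [r] have mass
    at most [r ^ p <= r]. The remaining pairs starting in [C] end in its enlargement. *)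
Lemma wasserstein_enlarge mu nu C (r : R) : Wp p mu -> Wp p nu -> measurable C ->
  0 < r -> r <= 1 -> W mu nu < r * r -> (mu C <= nu (enlarge C r) + r%:E)%E.
Proof.
move=> Wmu Wnu mC r0 r1 wr.
have [pi cpl cost] := wasserstein_coupling sepE p1 Wmu Wnu wr.
pose S : set (BE * BE) := [set z | r `^ p <= distE z.1 z.2 `^ p].
have mG : measurable_fun setT (fun z : BE * BE => distE z.1 z.2 `^ p).
  exact: (measurableT_comp (measurable_powR p) (measurable_dist2 sepE)).
have mS : measurable S.
  rewrite (_ : S = setT `&` (fun z : BE * BE => distE z.1 z.2 `^ p) @^-1` `[r `^ p, +oo[).
    exact: mG.
  by rewrite setTI; apply/seteqP; split=> z; rewrite /S /preimage/= in_itv/= andbT.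
have rp : 0 < r `^ p by rewrite powR_gt0.
have piS : (pi S <= r%:E)%E.
  have := @le_integral_comp_abse _ _ _ pi setT measurableT
    (fun z : BE * BE => (distE z.1 z.2 `^ p)%:E) (r `^ p) id
    (@measurable_id _ _ setT) (fun _ h => h) (fun _ _ _ _ h => h)
    (measurable_powR_dist2 sepE p) rp.
  rewrite setTI.
  have -> : [set z : BE * BE | ((r `^ p)%:E <= `|(distE z.1 z.2 `^ p)%:E|)%E] = S.
    by apply/seteqP; split=> z; rewrite /S /= lee_fin ger0_norm ?powR_ge0.
  have -> : (\int[pi]_z `|(distE z.1 z.2 `^ p)%:E| = transport_cost p pi)%E.
    by apply: eq_integral => z _; rewrite gee0_abs// powR_ge0E.
  move=> /le_lt_trans/(_ cost)/ltW.
  rewrite powRM ?(ltW r0)// EFinM lee_pmul2l// ?lte_fin// => /le_trans; apply.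
  by rewrite lee_fin ge1r_powR// r0.
have [<- _] := cpl C mC; have [_ <-] := cpl _ (enlarge_borel C r).
apply: (@le_trans _ _ (pi ((setT `*` enlarge C r) `|` S))); last first.
  apply: (@le_trans _ _ (pi (setT `*` enlarge C r) + pi S)%E); last exact: leeD2l.
  apply: measureU2 => //; apply: measurableX => //; exact: enlarge_borel.
apply: le_measure; rewrite ?inE.
- exact: measurableX.
- by apply: measurableU => //; apply: measurableX => //; exact: enlarge_borel.
move=> [c y] /= [Cc _]; have [cy|cy] := ltP (distE c y) r.
  by left; split=> //; exists c => //; rewrite distEC.
by right; rewrite /S/= ge0_ler_powR ?nnegrE ?(ltW r0) ?(ltW p0)//; exact: normr_ge0.
Qed.

(** Enlargements of a closed set decrease to it, so continuity from above applies. The radius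
    [r + r] reflects two chained approximations. *)
Lemma closed_le_enlarge mu nu C : closed (C : set E) ->
  (forall r : R, 0 < r -> r <= 1 -> (mu C <= nu (enlarge C (r + r)) + (r + r)%:E)%E) ->
  (mu C <= nu C)%E.
Proof.
move=> cC h; pose F (n : nat) : set BE := enlarge C (n.+1%:R^-1 + n.+1%:R^-1).
have FC : \bigcap_n F n = C.
  apply/seteqP; split; last first.
    move=> y Cy n _; exists y => //; rewrite /distE subrr normr0.
    by rewrite addr_gt0// invr_gt0.
  move=> y Fy; apply: contrapT => nCy.
  have : nbhs (y : E) (~` (C : set E)) by apply: open_nbhs_nbhs; split=> //; exact: closed_openC.
  rewrite -nbhs_ballE => -[r /= r0 ball].
  have r20 : 0 < r / 2 by rewrite divr_gt0.
  have [k _ hk] := near_infty_natSinv_lt (PosNum r20).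
  have {hk} kr : k.+1%:R^-1 < r / 2 := hk k (leqnn k).
  have [c Cc yc] := Fy k I; apply: (ball c) Cc; rewrite -ball_normE /=.
  by apply: (lt_trans yc); rewrite [ltRHS]splitr ltrD.
have cF : (nu \o F) n @[n --> \oo] --> nu C.
  rewrite -[in X in _ --> X]FC; apply: nonincreasing_cvg_mu.
  - by rewrite (le_lt_trans (probability_le1 _ _)) ?ltry//; exact: enlarge_borel.
  - by move=> n; exact: enlarge_borel.
  - by rewrite FC; exact: closed_borel.
  - move=> m n mn; apply/subsetPset => y [c Cc yc]; exists c => //.
    have le : n.+1%:R^-1 <= m.+1%:R^-1 :> R.
      by rewrite lef_pV2 ?posrE// ler_nat ltnS.
    by rewrite (lt_le_trans yc)// lerD.
have c0 : (n.+1%:R^-1 + n.+1%:R^-1 : R)%:E @[n --> \oo] --> 0%:E.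
  apply: cvg_EFin; first exact: nearW.
  by rewrite -(addr0 0); apply: cvgD; exact: cvg_harmonic.
have cS : ((nu \o F) n + (n.+1%:R^-1 + n.+1%:R^-1 : R)%:E)%E @[n --> \oo] --> nu C.
  rewrite -[nu C]adde0; apply: cvgeD => //.
  by rewrite fin_num_adde_defl.
apply: cvge_ge cS; apply: nearW => n; apply: h; first by rewrite invr_gt0.
by rewrite invf_le1// ler1n.
Qed.

(** Complements give agreement on open sets, an intersection-stable generator of the Borel sets. *)
Lemma eq_probability_closed mu nu :
  (forall C, closed (C : set E) -> mu C = nu C) ->
  forall A, measurable A -> mu A = nu A.
Proof.
move=> h; apply: (@measure_unique _ _ BE (@open E) (fun=> setT)) => //.
- by move=> A B oA oB; exact: openI.
- by move=> _; exact: openT.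
- by rewrite bigcup_const//; exists 0%N.
- move=> A oA; have mA : measurable (~` A : set BE).
    by apply: measurableC; exact: open_borel oA.
  have e (m : probability BE R) : m A = (1 - m (~` A))%E :> \bar R.
    by rewrite -[in LHS](setCK A); exact: (probability_setC m mA).
  apply: (etrans (e mu)); apply: (etrans _ (esym (e nu))).
  by rewrite h//; exact: open_closedC.
- by move=> _; rewrite [ltLHS](@probability_setT _ _ _ mu) ltry.
Qed.

Lemma eq_probability_approx rho sigma : Wp p rho -> Wp p sigma ->
  (forall r : R, 0 < r -> exists tau tau' : probability BE R,
    [/\ Wp p tau, Wp p tau', (forall A, measurable A -> tau A = tau' A),
      W rho tau < r & W tau' sigma < r]) ->
  forall A, measurable A -> rho A = sigma A.
Proof.
move=> Wr Ws approx; apply: eq_probability_closed => C cC.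
have mC := closed_borel cC.
have sub (r : R) : enlarge (enlarge C r) r `<=` enlarge C (r + r).
  move=> y [c [b Cb cb] yc]; exists b => //.
  by rewrite (le_lt_trans (distE_triangle c y b))// ltrD.
have le2 nu r : (nu (enlarge (enlarge C r) r) <= nu (enlarge C (r + r)))%E.
  by apply: le_measure; rewrite ?inE//; exact: enlarge_borel.
apply/eqP; rewrite eq_le; apply/andP; split; apply: closed_le_enlarge => // r r0 r1.
  have [tau [tau' [Wt Wt' tt h1 h2]]] := approx (r * r) (mulr_gt0 r0 r0).
  have := wasserstein_enlarge Wr Wt mC r0 r1 h1.
  move=> /le_trans; apply; rewrite EFinD addeA leeD2r// tt; last exact: enlarge_borel.
  have := wasserstein_enlarge Wt' Ws (enlarge_borel C r) r0 r1 h2.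
  by move=> /le_trans; apply; exact: leeD2r.
have [tau [tau' [Wt Wt' tt h1 h2]]] := approx (r * r) (mulr_gt0 r0 r0).
rewrite (wasserstein_sym sepE) in h1; rewrite (wasserstein_sym sepE) in h2.
have := wasserstein_enlarge Ws Wt' mC r0 r1 h2.
move=> /le_trans; apply; rewrite EFinD addeA leeD2r// -tt; last exact: enlarge_borel.
have := wasserstein_enlarge Wt Wr (enlarge_borel C r) r0 r1 h1.
by move=> /le_trans; apply; exact: leeD2r.
Qed.

End Approximation.

(** * Rigidity of isometries *)

Section Rigidity.
Variables (R : realType) (E : normedModType R) (ip : E -> E -> R).
Hypotheses (ipN : inner_product_inducing_norm ip) (sepE : separable_space E).
Variable p : R.
Hypotheses (p1 : 1 <= p) (peven : ~ exists k : nat, p = (2 * k)%:R).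
Local Notation BE := (borel E).
Local Notation W := (wasserstein p).
Implicit Types (mu nu : probability BE R) (x y : E).

Let p0 : 0 < p. Proof. exact: lt_le_trans p1. Qed.

Lemma potential_atoms_eq mu nu : Wp p mu -> Wp p nu ->
  (forall x, moment p mu x = moment p nu x) -> forall x, mu [set x] = nu [set x].
Proof.
(* The difference argument needs a unit vector; in the zero space each singleton is everything. *)
move=> Wmu Wnu mom x; have [[v v0]|triv] := pselect (exists v : E, v != 0).
  exact: (potential_atoms ipN sepE p1 peven (normfZV v0) Wmu Wnu mom).
have -> : [set x] = [set: E].
  apply/seteqP; split=> // y _; have E0 (z : E) : z = 0.
    by apply/eqP; apply: contrapT => /negP z0; apply: triv; exists z.
  by rewrite (E0 x) (E0 y).
by apply: etrans (esym _); exact: probability_setT.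
Qed.

Lemma wasserstein_diracs mu nu x y : mu [set x] = 1%E -> nu [set y] = 1%E ->
  W mu nu = distE x y.
Proof.
move=> mux nuy; apply: (powR_injective p0).
- exact: wasserstein_ge0.
- exact: normr_ge0.
by rewrite /= (wasserstein_dirac sepE p1 _ nuy) (moment_dirac _ _ mux).
Qed.

(** Stewart's identity computes the distance from [psi w] to the combination of images out of
    distances that [psi] preserves; it equals the distance from [w] to itself. *)
Lemma isometry_affine (psi : E -> E) :
  (forall x y, `|psi x - psi y| = `|x - y|) -> forall x y (t : R),
  psi (t *: x + (1 - t) *: y) = t *: psi x + (1 - t) *: psi y.
Proof.
move=> iso x y t; set w := t *: x + _; apply/esym/eqP.
rewrite -subr_eq0 -normr_eq0 -sqrf_eq0 (norm_sqr_convex ipN) !iso.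
by rewrite -(norm_sqr_convex ipN) subrr normr0 expr0n.
Qed.

(** * The map induced on points, and its agreement with [Phi] *)

Variable Phi : probability BE R -> probability BE R.
Hypothesis Phi_bij : set_bij (Wp p) (Wp p) Phi.
Hypothesis Phi_iso : forall mu nu, Wp p mu -> Wp p nu ->
  W (Phi mu) (Phi nu) = W mu nu.

Let PhiW mu : Wp p mu -> Wp p (Phi mu).
Proof. by have [h _ _] := Phi_bij => Wmu; apply: h. Qed.

Let Phi_surj nu : Wp p nu -> exists2 mu, Wp p mu & Phi mu = nu.
Proof. by have [_ _ h] := Phi_bij => /h[mu]; exists mu. Qed.

Lemma Phi_extends mu : Wp p mu ->
  extends_geodesics p (Phi mu) <-> extends_geodesics p mu.
Proof.
move=> Wmu; split=> ext nu Wnu.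
  have [eta' /Phi_surj[eta Weta <-]] := ext _ (PhiW Wnu).
  by rewrite !Phi_iso// => ?; exists eta.
have [nu' Wnu' <-] := Phi_surj Wnu; have [eta Weta h] := ext _ Wnu'.
by exists (Phi eta); [exact: PhiW|rewrite !Phi_iso].
Qed.

Lemma Phi_dirac mu : Wp p mu ->
  (exists x, (Phi mu) [set x] = 1%E) <-> (exists x, mu [set x] = 1%E).
Proof.
move=> Wmu; split=> -[x] h.
  have ext := proj1 (Phi_extends Wmu) (dirac_extends sepE p1 h).
  exact: (extends_dirac sepE p1 ipN Wmu ext).
have ext := proj2 (Phi_extends Wmu) (dirac_extends sepE p1 h).
exact: (extends_dirac sepE p1 ipN (PhiW Wmu) ext).
Qed.

Variable dlt : E -> probability BE R.
Hypothesis dltE : forall x, dlt x [set x] = 1%E.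
Variable psi : E -> E.
Hypothesis psiE : forall x, Phi (dlt x) [set psi x] = 1%E.

Let Wdlt x : Wp p (dlt x). Proof. exact: (Wp_dirac sepE p1 (dltE x)). Qed.

Lemma psi_iso x y : `|psi x - psi y| = `|x - y|.
Proof.
have := Phi_iso (Wdlt x) (Wdlt y).
by rewrite (wasserstein_diracs (psiE x) (psiE y)) (wasserstein_diracs (dltE x) (dltE y)).
Qed.

(** The preimage of a Dirac mass at [y] is Dirac, at some [x]. As it has distance 0 to [dlt x], so
    do their images, whence [psi x = y]. *)
Lemma psi_surj y : exists x, psi x = y.
Proof.
have [mu Wmu muE] := Phi_surj (Wdlt y).
have [x mux] : exists x, mu [set x] = 1%E.
  by apply/(Phi_dirac Wmu); exists y; rewrite muE.
exists x; have := Phi_iso (Wdlt x) Wmu.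
rewrite muE (wasserstein_diracs (psiE x) (dltE y)).
rewrite (wasserstein_diracs (dltE x) mux) /distE subrr normr0 => /eqP.
by rewrite normr_eq0 subr_eq0 => /eqP.
Qed.

Lemma psi_bij : bijective psi.
Proof.
have [g gK] := choice psi_surj; exists g => // x; apply/eqP.
by rewrite -subr_eq0 -normr_eq0 -psi_iso gK subrr normr0.
Qed.

Lemma measurable_psi : measurable_fun setT (psi : BE -> BE).
Proof.
apply: continuous_borel_map => x; apply/cvgrPdist_lt => eps eps0.
near=> y; rewrite psi_iso; near: y.
by apply/nbhs_ballP; exists eps => //= y; rewrite -ball_normE.
Unshelve. all: by end_near.
Qed.

Lemma moment_psi mu x : moment p (law mu measurable_psi) (psi x) = moment p mu x.
Proof.
apply: etrans (ge0_integral_law mu measurable_psi (measurable_powR_dist p (psi x))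
  (fun=> powR_ge0E _ _)) _.
by apply: eq_integral => y _; rewrite /distE psi_iso.
Qed.

Lemma Wp_psi mu : Wp p mu -> Wp p (law mu measurable_psi).
Proof.
move=> Wmu; apply: (proj2 (Wp_moment sepE p1 _ (psi 0))); rewrite moment_psi.
exact: (proj1 (Wp_moment sepE p1 mu 0) Wmu).
Qed.

(** A moment is the [p]-th power of a distance to a Dirac mass, and [Phi] preserves that
    distance. *)
Lemma moment_Phi mu x : Wp p mu -> moment p (Phi mu) (psi x) = moment p mu x.
Proof.
move=> Wmu.
rewrite -[LHS](fineK (moment_fin sepE p1 _ (PhiW Wmu))).
rewrite -[RHS](fineK (moment_fin sepE p1 _ Wmu)).
rewrite -(wasserstein_dirac sepE p1 _ (psiE x)).
by rewrite -(wasserstein_dirac sepE p1 _ (dltE x)) Phi_iso.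
Qed.

Lemma Phi_atomic mu (e : nat -> E) : Wp p mu -> mu (range e) = 1%E ->
  forall A, measurable A -> Phi mu A = law mu measurable_psi A.
Proof.
(* The sides are exchanged because the image under [psi] is the measure known to be atomic. *)
move=> Wmu mue A mA; apply/esym.
apply: (@eq_probability_atoms _ _ _ _ (psi \o e)) => //.
  apply: potential_atoms_eq; [exact: Wp_psi|exact: PhiW|move=> y].
  by have [x <-] := psi_surj y; rewrite moment_psi moment_Phi.
apply: (probability_sub1 (range_borel e) _ _ mue).
  by rewrite -[X in measurable X]setTI; apply: measurable_psi => //; exact: range_borel.
by move=> _ [n _ <-]; exists n.
Qed.

Lemma Phi_pushforward mu : Wp p mu ->
  forall A, measurable A -> Phi mu A = law mu measurable_psi A.
Proof.
move=> Wmu; apply: (eq_probability_approx sepE p1 (PhiW Wmu) (Wp_psi Wmu)) => r r0.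
have r20 : 0 < r / 2 by rewrite divr_gt0.
have r2r : r / 2 < r by rewrite ltr_pdivrMr// ltr_pMr// ltr1n.
have [f [e [mf fr fe]]] := countable_range_approx sepE r20.
have Wf : Wp p (law mu mf) by apply: (Wp_law sepE p1) Wmu => x; exact: ltW.
have mpf : measurable_fun setT (psi \o f : BE -> BE).
  exact: (measurableT_comp measurable_psi mf).
(* [f] moves points by less than [r / 2], and so does its composite with [psi] relative to [psi].
   The two approximants agree by the atomic case. *)
exists (Phi (law mu mf)), (law mu mpf); split.
- exact: PhiW.
- exact: (Wp_psi Wf).
- have fT : f @^-1` range e = setT.
    by apply/seteqP; split=> // x _; exact: fe.
  apply: (Phi_atomic Wf (e := e)); rewrite lawE fT; exact: probability_setT.
- rewrite Phi_iso// (wasserstein_sym sepE); apply: le_lt_trans r2r.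
  rewrite (eq_wasserstein p (law mu mf) (nu' := law mu (@measurable_id _ BE setT)))//.
  apply: (wasserstein_law_le sepE p1 _ _ (ltW r20)).
  apply: (integral_powR_dist_small sepE p1 mu (ltW r20) mf) => // x.
  exact: ltW.
apply: le_lt_trans r2r; apply: (wasserstein_law_le sepE p1 _ _ (ltW r20)).
apply: (integral_powR_dist_small sepE p1 mu (ltW r20) mpf measurable_psi) => x.
by rewrite /distE /= psi_iso; exact: ltW (fr x).
Qed.

End Rigidity.

Unset Implicit Arguments.

Theorem theorem3p10 (R : realType) (E : completeNormedModType R)
    (HE : hilbert_space E) (sepE : separable_space E)
    (p : R) (hp1 : 1 <= p) (hpeven : ~ exists k : nat, p = (2 * k)%:R)
    (Phi : probability (borel E) R -> probability (borel E) R)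
    (Phi_bij : set_bij (Wp p) (Wp p) Phi)
    (Phi_iso : forall mu nu, Wp p mu -> Wp p nu ->
       wasserstein p (Phi mu) (Phi nu) = wasserstein p mu nu) :
  exists psi : E -> E,
    [/\ bijective psi,
        (forall x y, `|psi x - psi y| = `|x - y|),
        (forall (x y : E) (t : R),
           psi (t *: x + (1 - t) *: y) = t *: psi x + (1 - t) *: psi y)
      & forall mu, Wp p mu ->
          forall A : set (borel E), measurable A ->
            Phi mu A = pushforward mu (psi : borel E -> borel E) A].
Proof.
have [ip ipN] := HE.
have [dlt dltE] : exists dlt : E -> probability (borel E) R,
    forall x, dlt x [set x] = 1%E.
  by exists (fun x => \d_(x : borel E)) => x; exact: dirac_set1.
(* Since [Phi] maps Dirac masses to Dirac masses, choice picks the location of each image. *)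
have [psi psiE] : {psi : E -> E & forall x, Phi (dlt x) [set psi x] = 1%E}.
  apply: (choice (P := fun x y => Phi (dlt x) [set y] = 1%E)) => x.
  have Wx := Wp_dirac sepE hp1 (dltE x).
  by apply: (proj2 (Phi_dirac ipN sepE hp1 Phi_bij Phi_iso Wx)); exists x.
have iso := psi_iso sepE hp1 Phi_iso dltE psiE.
exists psi; split.
- exact: (psi_bij ipN sepE hp1 Phi_bij Phi_iso dltE psiE).
- exact: iso.
- exact: (isometry_affine ipN iso).
- exact: (Phi_pushforward ipN sepE hp1 hpeven Phi_bij Phi_iso dltE psiE).
Qed.
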